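(* For every $n\ge 1$, $n$-equivalences in $\mathsf{Cat}^n_{\mathsf{hd}}$ have the $2$-out-of-$3$ property. In particular, for every $X\in\mathsf{Cat}^n_{\mathsf{hd}}$ the maps $\gamma^{(n)}:X\to d^{(n)}p^{(n)}X$ and $\gamma_{(n)}:X\to X^d$ are $n$-equivalences.
   Context: **$n$-fold categories.** $\mathsf{Cat}^0=\mathsf{Set}$, $\mathsf{Cat}^1=\mathsf{Cat}$ (small categories and functors), and $\mathsf{Cat}^n=\mathsf{Cat}(\mathsf{Cat}^{n-1})$ is the category of internal categories and internal functors in $\mathsf{Cat}^{n-1}$. Iterating the nerve gives the fully faithful multinerve $N_{(n)}:\mathsf{Cat}^n\to[(\Delta^{op})^n,\mathsf{Set}]$, and via it we identify $\mathsf{Cat}^n$ with the full subcategory of $n$-simplicial sets $X$ whose Segal maps in each of the $n$ simplicial directions are isomorphisms. For $X\in\mathsf{Cat}^n$ and $s\ge 0$, $X_s\in\mathsf{Cat}^{n-1}$ denotes $X(s,-,\dots,-)$; thus $\mathsf{Cat}^n$ is the category of simplicial objects in $\mathsf{Cat}^{n-1}$ whose Segal maps are isomorphisms. $X_{s_1\dots s_{n-1}}\in\mathsf{Cat}$ denotes the category whose nerve is $X(s_1,\dots,s_{n-1},-)$. An $n$-fold category is discrete if its multinerve is a constant functor. **Homotopically discrete $n$-fold categories.** Let $p:\mathsf{Cat}\to\mathsf{Set}$ send a category to its set of isomorphism classes of objects. Set $\mathsf{Cat}^0_{\mathsf{hd}}=\mathsf{Set}$, let $\mathsf{Cat}^1_{\mathsf{hd}}=\mathsf{Cat}_{\mathsf{hd}}$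 be the full subcategory of $\mathsf{Cat}$ of equivalence relations (groupoids equivalent to discrete categories), and let $p^{(1)}$ be the restriction of $p$. Inductively, for $n\ge2$, $\mathsf{Cat}^n_{\mathsf{hd}}$ is the full subcategory of $[\Delta^{op},\mathsf{Cat}^{n-1}_{\mathsf{hd}}]$ on those $X$ such that (i) the Segal maps $X_s\to X_1\times_{X_0}\overset{s}{\cdots}\times_{X_0}X_1$ are isomorphisms for all $s\ge 2$ (so $X\in\mathsf{Cat}^n$); (ii) the simplicial object $s\mapsto p^{(n-1)}(X_s)$ in $\mathsf{Cat}^{n-2}_{\mathsf{hd}}$ is (the nerve in the first direction of) an object of $\mathsf{Cat}^{n-1}_{\mathsf{hd}}$; this object is denoted $p^{(n)}X$, giving a functor $p^{(n)}:\mathsf{Cat}^n_{\mathsf{hd}}\to\mathsf{Cat}^{n-1}_{\mathsf{hd}}$. Equivalently, $(p^{(n)}X)_{s_1\dots s_{n-1}}=p(X_{s_1\dots s_{n-1}})$. **Discretization.** Let $d:\mathsf{Set}\to\mathsf{Cat}$ be the discrete category functor, and let $d^{(n)}:\mathsf{Cat}^{n-1}\to\mathsf{Cat}^n$ be the discrete inclusion in the $n$-th direction: $(d^{(n)}Y)_{s_1\dots s_{n-1}}=d(Y_{s_1\dots s_{n-1}})$, with $d^{(1)}=d$. For $X\in\mathsf{Cat}^n_{\mathsf{hd}}$ let $\gamma^{(n)}=\gamma^{(n)}_X:X\to d^{(n)}p^{(n)}X$ be given levelwise by the canonical functors $X_{s_1\dots s_{n-1}}\to d\,p\,X_{s_1\dots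 s_{n-1}}$ (sending each object to its isomorphism class). Put $X^d=d^{(n)}\cdots d^{(1)}p^{(1)}\cdots p^{(n)}X$ (a discrete $n$-fold category, functorial in $X$), and let $\gamma_{(n)}:X\to X^d$ be the composite $X\xrightarrow{\gamma^{(n)}}d^{(n)}p^{(n)}X\xrightarrow{d^{(n)}\gamma^{(n-1)}}d^{(n)}d^{(n-1)}p^{(n-1)}p^{(n)}X\to\cdots\to X^d$. **$n$-equivalences.** A $1$-equivalence in $\mathsf{Cat}^1_{\mathsf{hd}}$ is an equivalence of categories. For $n\ge2$, $X\in\mathsf{Cat}^n_{\mathsf{hd}}$ and $a,b\in X_0^d=(X_0)^d$ (elements of the underlying set), $X(a,b)$ is the fiber at $(a,b)$ of the composite $X_1\xrightarrow{(d_0,d_1)}X_0\times X_0\xrightarrow{\gamma\times\gamma}X_0^d\times X_0^d$, where $\gamma=\gamma_{(n-1)}:X_0\to X_0^d$ is the discretization map of $X_0\in\mathsf{Cat}^{n-1}_{\mathsf{hd}}$. A map $f:X\to Y$ in $\mathsf{Cat}^n_{\mathsf{hd}}$ is an $n$-equivalence if for all $a,b\in X_0^d$ the induced map $f(a,b):X(a,b)\to Y(fa,fb)$ is an $(n-1)$-equivalence and $p^{(n)}f$ is an $(n-1)$-equivalence. The $2$-out-of-$3$ property: for composable maps $f,g$, if two of $f$, $g$, $gf$ are $n$-equivalences then so is the third. *)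

(* Defs.v *)
From Stdlib Require Import Relation_Operators.
From mathcomp Require Import all_boot boolp.

Set Implicit Arguments.
Unset Strict Implicit.
Unset Printing Implicit Defensive.

Record category := Category {
  ob :> Type;
  hom : ob -> ob -> Type;
  idm : forall x, hom x x;
  ccomp : forall x y z, hom y z -> hom x y -> hom x z;
  comp1m : forall x y (f : hom x y), ccomp (idm y) f = f;
  compm1 : forall x y (f : hom x y), ccomp f (idm x) = f;
  compA : forall x y z t (h : hom z t) (g : hom y z) (f : hom x y),
    ccomp h (ccomp g f) = ccomp (ccomp h g) f
}.
Arguments hom {c} x y.
Arguments idm {c} x.
Notation "g ∘ f" := (ccomp g f) (at level 40, left associativity).

Definition is_iso (C : category) (x y : C) (f : hom x y) : Prop :=
  exists g : hom y x, g ∘ f = idm x /\ f ∘ g = idm y.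

Record functor (C D : category) := Functor {
  fobj :> ob C -> ob D;
  fmap : forall x y, hom x y -> hom (fobj x) (fobj y);
  fmap1 : forall x, fmap (idm x) = idm (fobj x);
  fmapM : forall x y z (g : hom y z) (f : hom x y),
    fmap (g ∘ f) = fmap g ∘ fmap f
}.
Arguments fmap {C D} f {x y} _ : rename.

Record nattrans (C D : category) (F G : functor C D) := NatTrans {
  ncomp :> forall x, hom (F x) (G x);
  natural : forall x y (f : hom x y), ncomp y ∘ fmap F f = fmap G f ∘ ncomp x
}.

Definition opposite (C : category) : category :=
  @Category C (fun x y => hom y x) (fun x => idm x) (fun _ _ _ g f => f ∘ g)
    (fun _ _ f => compm1 f) (fun _ _ f => comp1m f)
    (fun _ _ _ _ h g f => esym (compA f g h)).

Definition SET : category :=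
  @Category Type (fun A B => A -> B) (fun A x => x)
    (fun _ _ _ g f x => g (f x))
    (fun _ _ _ => erefl) (fun _ _ _ => erefl) (fun _ _ _ _ _ _ _ => erefl).

Definition idf (C : category) : functor C C :=
  @Functor C C (fun x => x) (fun _ _ f => f)
    (fun _ => erefl) (fun _ _ _ _ _ => erefl).

Section FunctorComposition.
Variables (C D E : category) (G : functor D E) (F : functor C D).

Lemma compf_map1 x : fmap G (fmap F (idm x)) = idm (G (F x)).
Proof. by rewrite !fmap1. Qed.

Lemma compf_mapM x y z (g : hom y z) (f : hom x y) :
  fmap G (fmap F (g ∘ f)) = fmap G (fmap F g) ∘ fmap G (fmap F f).
Proof. by rewrite !fmapM. Qed.

Definition compf : functor C E :=
  @Functor C E (fun x => G (F x)) (fun _ _ f => fmap G (fmap F f))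
    compf_map1 compf_mapM.
End FunctorComposition.

Lemma nattrans_eq (C D : category) (F G : functor C D) (s t : nattrans F G) :
  (forall x, s x = t x) -> s = t.
Proof.
case: s t => [s sP] [t tP] /= e.
have {}e : s = t by apply: functional_extensionality_dep.
by case: _ / e tP => tP; congr NatTrans; apply: Prop_irrelevance.
Qed.

Section FunctorCategory.
Variables C D : category.

Lemma idn_natural (F : functor C D) x y (f : hom x y) :
  idm (F y) ∘ fmap F f = fmap F f ∘ idm (F x).
Proof. by rewrite comp1m compm1. Qed.

Definition idn (F : functor C D) : nattrans F F := NatTrans (@idn_natural F).

Lemma compn_natural (F G H : functor C D) (t : nattrans G H) (s : nattrans F G)
  x y (f : hom x y) : (t y ∘ s y) ∘ fmap F f = fmap H f ∘ (t x ∘ s x).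
Proof. by rewrite -compA natural !compA natural. Qed.

Definition compn (F G H : functor C D) (t : nattrans G H) (s : nattrans F G) :
  nattrans F H := NatTrans (compn_natural t s).

Lemma comp1n F G (s : nattrans F G) : compn (idn G) s = s.
Proof. by apply: nattrans_eq => x /=; rewrite comp1m. Qed.

Lemma compn1 F G (s : nattrans F G) : compn s (idn F) = s.
Proof. by apply: nattrans_eq => x /=; rewrite compm1. Qed.

Lemma compnA F G H K (u : nattrans H K) (t : nattrans G H) (s : nattrans F G) :
  compn u (compn t s) = compn (compn u t) s.
Proof. by apply: nattrans_eq => x /=; rewrite compA. Qed.

Definition functor_category : category := Category comp1n compn1 compnA.
End FunctorCategory.

Section Postcomposition.
Variables (J C D : category) (F : functor C D).

Lemma postcomp_natural (X Y : functor J C) (s : nattrans X Y) i j (f : hom i j) :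
  fmap F (s j) ∘ fmap F (fmap X f) = fmap F (fmap Y f) ∘ fmap F (s i).
Proof. by rewrite -!fmapM natural. Qed.

Definition postcomp_map (X Y : functor_category J C) (s : hom X Y) :
  hom (compf F X : functor_category J D) (compf F Y) :=
  @NatTrans _ _ (compf F X) (compf F Y) (fun j => fmap F (s j))
    (postcomp_natural s).

Lemma postcomp_map1 X : postcomp_map (idm X) = idm _.
Proof. by apply: nattrans_eq => j /=; rewrite fmap1. Qed.

Lemma postcomp_mapM X Y Z (t : hom Y Z) (s : hom X Y) :
  postcomp_map (t ∘ s) = postcomp_map t ∘ postcomp_map s.
Proof. by apply: nattrans_eq => j /=; rewrite fmapM. Qed.

Definition postcomp : functor (functor_category J C) (functor_category J D) :=
  @Functor (functor_category J C) (functor_category J D)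
    (fun X => compf F X) postcomp_map postcomp_map1 postcomp_mapM.
End Postcomposition.

Section FullSubcategory.
Variables (C : category) (P : C -> Prop).

Record full_ob := FullOb { full_val :> C; full_valP : P full_val }.

Definition full_subcategory : category :=
  @Category full_ob (fun x y => hom (full_val x) (full_val y))
    (fun x => idm (full_val x)) (fun _ _ _ g f => g ∘ f)
    (fun _ _ f => comp1m f) (fun _ _ f => compm1 f)
    (fun _ _ _ _ h g f => compA h g f).

Definition inclusion : functor full_subcategory C :=
  @Functor full_subcategory C full_val (fun _ _ f => f)
    (fun _ => erefl) (fun _ _ _ _ _ => erefl).
End FullSubcategory.

(** A diagram indexed by a graph. *)
Record diagram (C : category) := Diagram {
  node : Type;
  edge : Type;
  dsrc : edge -> node;
  dtgt : edge -> node;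
  dob : node -> C;
  dmap : forall e, hom (dob (dsrc e)) (dob (dtgt e))
}.
Arguments dob {C} d v.
Arguments dmap {C} d e.

Record cone (C : category) (D : diagram C) (T : C) := Cone {
  leg :> forall v, hom T (dob D v);
  legP : forall e, dmap D e ∘ leg (dsrc e) = leg (dtgt e)
}.

Record limit (C : category) (D : diagram C) := Limit {
  lim :> C;
  proj : cone D lim;
  lim_lift : forall T, cone D T -> hom T lim;
  lim_liftP : forall T (c : cone D T) v, proj v ∘ lim_lift c = c v;
  lim_lift_uniq : forall T (f g : hom T lim),
    (forall v, proj v ∘ f = proj v ∘ g) -> f = g
}.
Arguments proj {C D} l.
Arguments lim_lift {C D} l {T} c.

Section LimitSet.
Variable D : diagram SET.

Definition compatible (x : forall v, dob D v) : Prop :=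
  forall e, dmap D e (x (dsrc e)) = x (dtgt e).

Definition set_lim : SET := {x | compatible x}.

Definition set_proj : cone D set_lim :=
  @Cone SET D set_lim (fun v x => sval x v)
    (fun e => funext (fun x : set_lim => proj2_sig x e)).

Definition set_lift (T : SET) (c : cone D T) : hom T set_lim := fun t =>
  exist compatible (fun v => c v t) (fun e => congr1 (@^~ t) (legP c e)).

Lemma set_lift_uniq (T : SET) (f g : hom T set_lim) :
  (forall v, set_proj v ∘ f = set_proj v ∘ g) -> f = g.
Proof.
move=> e; apply: funext => t.
have: sval (f t) = sval (g t).
  by apply: functional_extensionality_dep => v; exact: (congr1 (@^~ t) (e v)).
by case: (f t) (g t) => [x xP] [y yP] /= exy; exact: eq_exist.
Qed.

Definition set_limit : limit D :=
  @Limit SET D set_lim set_proj set_lift (fun _ _ _ => erefl) set_lift_uniq.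
End LimitSet.

Section LimitFunctor.
Variables (J C : category) (limC : forall D : diagram C, limit D).
Variable D : diagram (functor_category J C).

Definition ev_diagram (j : J) : diagram C :=
  @Diagram C (node D) (edge D) (@dsrc _ D) (@dtgt _ D)
    (fun v => (dob D v : functor J C) j)
    (fun e => (dmap D e : nattrans _ _) j).

Definition ev_cone (T : functor_category J C) (c : cone D T) (j : J) :
  cone (ev_diagram j) ((T : functor J C) j) :=
  @Cone C (ev_diagram j) _ (fun v => (c v : nattrans _ _) j)
    (fun e => congr1 (fun s : nattrans _ _ => s j) (legP c e)).

Definition flim_cone_leg i j (f : hom i j) (v : node D) :
  hom (limC (ev_diagram i) : C) (dob (ev_diagram j) v) :=
  fmap (dob D v : functor J C) f ∘ proj (limC (ev_diagram i)) v.

Lemma flim_cone_legP i j (f : hom i j) (e : edge D) :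
  dmap (ev_diagram j) e ∘ flim_cone_leg f (dsrc e) = flim_cone_leg f (dtgt e).
Proof.
rewrite /flim_cone_leg /= compA natural -compA.
by rewrite (legP (proj (limC (ev_diagram i))) e).
Qed.

Definition flim_cone i j (f : hom i j) :
  cone (ev_diagram j) (limC (ev_diagram i)) :=
  @Cone C (ev_diagram j) _ (flim_cone_leg f) (flim_cone_legP f).

Definition flim_map i j (f : hom i j) :
  hom (limC (ev_diagram i) : C) (limC (ev_diagram j)) := lim_lift (limC _) (flim_cone f).

Lemma flim_map1 i : flim_map (idm i) = idm _.
Proof. by apply: lim_lift_uniq => v; rewrite lim_liftP /= /flim_cone_leg fmap1 comp1m compm1. Qed.

Lemma flim_mapM i j k (g : hom j k) (f : hom i j) :
  flim_map (g ∘ f) = flim_map g ∘ flim_map f.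
Proof.
apply: lim_lift_uniq => v; rewrite lim_liftP compA lim_liftP /= /flim_cone_leg -compA.
by rewrite [X in _ = _ ∘ X]lim_liftP /= /flim_cone_leg fmapM compA.
Qed.

Definition flim : functor J C :=
  @Functor J C (fun j => limC (ev_diagram j)) flim_map flim_map1 flim_mapM.

Definition flim_leg v : nattrans flim (dob D v) :=
  @NatTrans J C flim (dob D v) (fun j => proj (limC (ev_diagram j)) v)
    (fun i j f => lim_liftP (limC (ev_diagram j)) (flim_cone f) v).

Lemma flim_legP e :
  (dmap D e ∘ (flim_leg (dsrc e) : hom (flim : functor_category J C) _))
  = flim_leg (dtgt e).
Proof.
by apply: nattrans_eq => j; exact: (legP (proj (limC (ev_diagram j))) e).
Qed.

Definition flim_proj : cone D (flim : functor_category J C) := Cone flim_legP.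

Lemma flim_lift_natural (T : functor_category J C) (c : cone D T) i j
    (f : hom i j) :
  lim_lift (limC (ev_diagram j)) (ev_cone c j) ∘ fmap (T : functor J C) f =
  fmap flim f ∘ lim_lift (limC (ev_diagram i)) (ev_cone c i).
Proof.
apply: lim_lift_uniq => v; rewrite !compA !lim_liftP /= natural -compA.
by congr ccomp; rewrite lim_liftP.
Qed.

Definition flim_lift (T : functor_category J C) (c : cone D T) :
  hom T (flim : functor_category J C) :=
  @NatTrans J C T flim (fun j => lim_lift (limC (ev_diagram j)) (ev_cone c j))
    (flim_lift_natural c).

Lemma flim_liftP T (c : cone D T) v : flim_proj v ∘ flim_lift c = c v.
Proof.
apply: nattrans_eq => j.
exact: (lim_liftP (limC (ev_diagram j)) (ev_cone c j) v).
Qed.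

Lemma flim_lift_uniq T (f g : hom T (flim : functor_category J C)) :
  (forall v, flim_proj v ∘ f = flim_proj v ∘ g) -> f = g.
Proof.
move=> e; apply: nattrans_eq => j; apply: lim_lift_uniq => v.
exact: (congr1 (fun s : nattrans _ _ => s j) (e v)).
Qed.

Definition functor_limit : limit D :=
  @Limit _ D (flim : functor_category J C) flim_proj flim_lift
    flim_liftP flim_lift_uniq.
End LimitFunctor.

Section ProductPullback.
Variables (C : category) (limC : forall D : diagram C, limit D).

Definition prod_diagram (x y : C) : diagram C :=
  @Diagram C bool Empty_set (fun _ => true) (fun _ => true)
    (fun b => if b then x else y) (fun e => match e with end).

Definition product (x y : C) : C := limC (prod_diagram x y).
Definition pfst (x y : C) : hom (product x y) x :=
  proj (limC (prod_diagram x y)) true.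
Definition psnd (x y : C) : hom (product x y) y :=
  proj (limC (prod_diagram x y)) false.

Definition pair_cone (t x y : C) (f : hom t x) (g : hom t y) :
  cone (prod_diagram x y) t :=
  @Cone C (prod_diagram x y) t
    (fun b => if b as b0 return hom t (if b0 then x else y) then f else g)
    (fun e => match e with end).

Definition pairing (t x y : C) (f : hom t x) (g : hom t y) :
  hom t (product x y) := lim_lift (limC _) (pair_cone f g).

Definition prod_map (x y x' y' : C) (f : hom x x') (g : hom y y') :
  hom (product x y) (product x' y') :=
  pairing (f ∘ pfst x y) (g ∘ psnd x y).

Definition pullback_diagram (x y z : C) (f : hom x z) (g : hom y z) :
  diagram C :=
  let o v := match v with None => z | Some b => if b then x else y end in
  @Diagram C (option bool) bool (fun b => Some b) (fun _ => None) o
    (fun b => if b as b0 return hom (o (Some b0)) (o None) then f else g).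

Definition pullback (x y z : C) (f : hom x z) (g : hom y z) : C :=
  limC (pullback_diagram f g).
Definition pb1 (x y z : C) (f : hom x z) (g : hom y z) :
  hom (pullback f g) x := proj (limC (pullback_diagram f g)) (Some true).
Definition pb2 (x y z : C) (f : hom x z) (g : hom y z) :
  hom (pullback f g) y := proj (limC (pullback_diagram f g)) (Some false).

Lemma pbP (x y z : C) (f : hom x z) (g : hom y z) : f ∘ pb1 f g = g ∘ pb2 f g.
Proof.
rewrite /pb1 /pb2.
have := legP (proj (limC (pullback_diagram f g))) true.
have := legP (proj (limC (pullback_diagram f g))) false.
by move=> /= -> ->.
Qed.

Definition pb_leg (t x y z : C) (f : hom x z) (g : hom y z)
    (u : hom t x) (v : hom t y) (w : node (pullback_diagram f g)) :
  hom t (dob (pullback_diagram f g) w) :=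
  match w as w' return hom t (dob (pullback_diagram f g) w') with
  | None => f ∘ u
  | Some true => u
  | Some false => v
  end.

Lemma pb_legP (t x y z : C) (f : hom x z) (g : hom y z)
    (u : hom t x) (v : hom t y) (e : f ∘ u = g ∘ v)
    (d : edge (pullback_diagram f g)) :
  dmap _ d ∘ pb_leg u v (dsrc d) = pb_leg u v (dtgt d).
Proof. by case: d => /=. Qed.

Definition pb_lift (t x y z : C) (f : hom x z) (g : hom y z)
    (u : hom t x) (v : hom t y) (e : f ∘ u = g ∘ v) : hom t (pullback f g) :=
  lim_lift (limC _) (Cone (pb_legP e)).

Lemma pfst_pairing (t x y : C) (f : hom t x) (g : hom t y) :
  pfst x y ∘ pairing f g = f.
Proof. exact: (lim_liftP (limC (prod_diagram x y)) (pair_cone f g) true). Qed.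

Lemma psnd_pairing (t x y : C) (f : hom t x) (g : hom t y) :
  psnd x y ∘ pairing f g = g.
Proof. exact: (lim_liftP (limC (prod_diagram x y)) (pair_cone f g) false). Qed.

Lemma pairing_eq (t x y : C) (f g : hom t (product x y)) :
  pfst x y ∘ f = pfst x y ∘ g -> psnd x y ∘ f = psnd x y ∘ g -> f = g.
Proof. by move=> e1 e2; apply: lim_lift_uniq; case. Qed.

Lemma pairing_comp (s t x y : C) (f : hom t x) (g : hom t y) (h : hom s t) :
  pairing f g ∘ h = pairing (f ∘ h) (g ∘ h).
Proof.
by apply: pairing_eq; rewrite compA ?pfst_pairing ?psnd_pairing.
Qed.

Lemma prod_map_pairing (t x y x' y' : C) (f : hom x x') (g : hom y y')
    (u : hom t x) (v : hom t y) :
  prod_map f g ∘ pairing u v = pairing (f ∘ u) (g ∘ v).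
Proof.
rewrite pairing_comp; congr pairing.
  by rewrite -compA pfst_pairing.
by rewrite -compA psnd_pairing.
Qed.
End ProductPullback.

(** The object [m : nat] of [Delta] stands for the ordinal {0 < ... < m}. *)
Definition is_monotone m n (f : 'I_m.+1 -> 'I_n.+1) : Prop :=
  forall i j : 'I_m.+1, i <= j -> f i <= f j.

Definition monotone m n := {f : 'I_m.+1 -> 'I_n.+1 | is_monotone f}.

Definition mono_id m : monotone m m := exist (@is_monotone m m) (fun i => i) (fun _ _ h => h).

Definition mono_comp m n k (g : monotone n k) (f : monotone m n) :
  monotone m k :=
  exist (@is_monotone m k) (fun i => sval g (sval f i))
    (fun i j h => proj2_sig g _ _ (proj2_sig f i j h)).

Lemma monotone_eq m n (f g : monotone m n) : sval f =1 sval g -> f = g.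
Proof. by case: f g => [f fP] [g gP] /= /funext e; exact: eq_exist. Qed.

Lemma mono_comp1m m n (f : monotone m n) : mono_comp (mono_id n) f = f.
Proof. exact: monotone_eq. Qed.

Lemma mono_compm1 m n (f : monotone m n) : mono_comp f (mono_id m) = f.
Proof. exact: monotone_eq. Qed.

Lemma mono_compA m n k l (h : monotone k l) (g : monotone n k)
    (f : monotone m n) :
  mono_comp h (mono_comp g f) = mono_comp (mono_comp h g) f.
Proof. exact: monotone_eq. Qed.

Definition Delta : category :=
  @Category nat monotone mono_id mono_comp mono_comp1m mono_compm1 mono_compA.

Definition simplicial (C : category) : category :=
  functor_category (opposite Delta) C.

(** [level X s] is X_s and [simpl_map X f : X_n -> X_m] the map induced by
    [f : [m] -> [n]]. *)
Definition level (C : category) (X : simplicial C) (s : nat) : C :=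
  fobj (X : functor _ _) s.

Definition simpl_map (C : category) (X : simplicial C) m n (f : monotone m n) :
  hom (level X n) (level X m) := @fmap _ _ (X : functor _ _) n m f.

Definition level_map (C : category) (X Y : simplicial C) (f : hom X Y) (s : nat) :
  hom (level X s) (level Y s) := (f : nattrans _ _) s.

Definition vertex n (i : 'I_n.+1) : monotone 0 n :=
  exist (@is_monotone 0 n) (fun _ => i) (fun _ _ _ => leqnn i).

Lemma arrow_subproof n (i j : 'I_n.+1) (h : i <= j) (a b : 'I_2) :
  a <= b -> (if a == ord0 then i else j) <= (if b == ord0 then i else j).
Proof. by case: a b => [[|[|?]] ?] [[|[|?]] ?]. Qed.

(** The map [1] -> [n] with 0 |-> i and 1 |-> j. *)
Definition arrow n (i j : 'I_n.+1) (h : i <= j) : monotone 1 n :=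
  exist (@is_monotone 1 n) (fun a : 'I_2 => if a == ord0 then i else j) (arrow_subproof h).

Section Segal.
Variables (C : category) (limC : forall D : diagram C, limit D).
Variable X : simplicial C.

(** Endpoints of an edge: [src] is d_1 and [tgt] is d_0. *)
Definition src : hom (level X 1) (level X 0) := simpl_map X (vertex (ord0 : 'I_2)).
Definition tgt : hom (level X 1) (level X 0) :=
  simpl_map X (vertex (ord_max : 'I_2)).

(** The zigzag X_0 <- X_1 -> X_0 <- ... -> X_0 with [s] copies of X_1, whose
    limit is the iterated fibre product of X_1 over X_0. *)
Definition segal_diagram (s : nat) : diagram C :=
  let o (v : 'I_s + 'I_s.+1) := if v is inl _ then level X 1 else level X 0 in
  @Diagram C ('I_s + 'I_s.+1) (bool * 'I_s)
    (fun e => inl e.2)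
    (fun e => inr (if e.1 then lift ord0 e.2 else widen_ord (leqnSn s) e.2))
    o (fun e => if e.1 then tgt else src).

Lemma spine_subproof s (i : 'I_s) : widen_ord (leqnSn s) i <= lift ord0 i.
Proof. by rewrite /= leqW. Qed.

Definition spine s (i : 'I_s) : monotone 1 s := arrow (spine_subproof i).

Definition segal_leg s (v : node (segal_diagram s)) :
  hom (level X s) (dob (segal_diagram s) v) :=
  match v with
  | inl i => simpl_map X (spine i)
  | inr j => simpl_map X (vertex j)
  end.

Lemma segal_legP s (e : edge (segal_diagram s)) :
  dmap (segal_diagram s) e ∘ segal_leg (dsrc e) = segal_leg (dtgt e).
Proof.
case: e => [[] i] /=; rewrite /src /tgt /simpl_map -fmapM;
  by congr fmap; apply: monotone_eq => a.
Qed.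

Definition segal_map (s : nat) : hom (level X s) (limC (segal_diagram s)) :=
  lim_lift (limC _) (Cone (@segal_legP s)).

Definition segal : Prop := forall s, 2 <= s -> is_iso (segal_map s).
End Segal.

(** [n]-simplicial sets; the outermost simplicial direction is the first one,
    so that [level X s] is X(s, -, ..., -). *)
Fixpoint mSet (n : nat) : category :=
  match n with
  | 0 => SET
  | n'.+1 => simplicial (mSet n')
  end.

Fixpoint mlim (n : nat) : forall D : diagram (mSet n), limit D :=
  match n with
  | 0 => set_limit
  | n'.+1 => functor_limit (@mlim n')
  end.

(** A simplicial set satisfying the Segal condition is identified with the
    category it is the nerve of: objects are the elements of X_0, arrows those
    of X_1, and composites are read off from X_2. *)
Section SimplicialSet.
Variable X : simplicial SET.

Definition identity (x : level X 0) : level X 1 :=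
  simpl_map X (exist (@is_monotone 1 0) (fun _ => ord0) (fun _ _ _ => leqnn _))
    x.

(** [is_composite u v w] means w = v ∘ u. *)
Definition is_composite (u v w : level X 1) : Prop :=
  exists t : level X 2,
    [/\ simpl_map X (@arrow 2 ord0 (lift ord0 ord0) isT) t = u,
        simpl_map X (@arrow 2 (lift ord0 ord0) ord_max isT) t = v
      & simpl_map X (@arrow 2 ord0 ord_max isT) t = w].

Definition invertible (u : level X 1) : Prop :=
  exists v, is_composite u v (identity (src X u)) /\
            is_composite v u (identity (tgt X u)).

Definition isomorphic (x y : level X 0) : Prop :=
  exists u, [/\ src X u = x, tgt X u = y & invertible u].

(** If [X] is the nerve of a category then [isomorphic] is already an
    equivalence relation; passing to the generated equivalence relation makes
    [iso_classes] a functor on all simplicial sets. *)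
Definition iso_class (x : level X 0) : level X 0 -> Prop :=
  clos_refl_sym_trans (level X 0) isomorphic x.

Definition iso_classes : Type :=
  {c : level X 0 -> Prop | exists x, c = iso_class x}.

Definition to_class (x : level X 0) : iso_classes :=
  exist (fun c => exists x, c = iso_class x) (iso_class x)
    (ex_intro _ x erefl).

Lemma to_class_eq x y : iso_class x y -> to_class x = to_class y.
Proof.
move=> xy; apply: eq_exist; apply/predeqP => z; split=> h.
  exact: rst_trans (rst_sym _ _ _ _ xy) h.
exact: rst_trans xy h.
Qed.

(** A groupoid with at most one arrow from any object to any other. *)
Definition equivalence_relation_category : Prop :=
  (forall u, invertible u) /\
  (forall u v, src X u = src X v -> tgt X u = tgt X v -> u = v).
End SimplicialSet.

Lemma level_map_natural (C : category) (X Y : simplicial C) (f : hom X Y)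
    m n (a : monotone m n) :
  level_map f m ∘ simpl_map X a = simpl_map Y a ∘ level_map f n.
Proof. exact: (natural (f : nattrans _ _)). Qed.

Section IsoClassesFunctor.
Variables (X Y : simplicial SET) (f : hom X Y).

Lemma level_map_set m n (a : monotone m n) x :
  level_map f m (simpl_map X a x) = simpl_map Y a (level_map f n x).
Proof. exact: (congr1 (@^~ x) (level_map_natural f a)). Qed.

Lemma is_composite_map u v w : is_composite u v w ->
  is_composite (level_map f 1 u) (level_map f 1 v) (level_map f 1 w).
Proof.
by case=> t [<- <- <-]; exists (level_map f 2 t); rewrite !level_map_set.
Qed.

Lemma invertible_map u : invertible u -> invertible (level_map f 1 u).
Proof.
case=> v [/is_composite_map h1 /is_composite_map h2].
by exists (level_map f 1 v); rewrite /src /tgt /identity -!level_map_set.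
Qed.

Lemma isomorphic_map x y : isomorphic x y ->
  isomorphic (level_map f 0 x) (level_map f 0 y).
Proof.
case=> u [<- <- /invertible_map ui]; exists (level_map f 1 u).
by rewrite /src /tgt -!level_map_set.
Qed.

Lemma iso_class_map x y : iso_class x y ->
  iso_class (level_map f 0 x) (level_map f 0 y).
Proof.
elim=> {x y} [x y /isomorphic_map h|x|x y _ h|x y z _ h1 _ h2].
- exact: rst_step.
- exact: rst_refl.
- exact: rst_sym.
- exact: rst_trans h1 h2.
Qed.

Lemma iso_classes_map_subproof (c : iso_classes X) : exists y : level Y 0,
  (fun z => exists2 x, sval c x & iso_class (level_map f 0 x) z) = iso_class y.
Proof.
case: c => c [x e]; exists (level_map f 0 x) => /=; rewrite {c}e.
apply/predeqP => z; split.
  by case=> x' /iso_class_map; exact: rst_trans.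
by exists x => //; exact: rst_refl.
Qed.

Definition iso_classes_map (c : iso_classes X) : iso_classes Y :=
  exist (fun c => exists y, c = iso_class y) _ (iso_classes_map_subproof c).

Lemma iso_classes_mapE x :
  iso_classes_map (to_class x) = to_class (level_map f 0 x).
Proof.
apply: eq_exist; apply/predeqP => z; split=> /=.
  by case=> x' /iso_class_map; exact: rst_trans.
by exists x => //; exact: rst_refl.
Qed.
End IsoClassesFunctor.

Lemma to_class_surj (X : simplicial SET) (c : iso_classes X) :
  exists x, c = to_class x.
Proof. by case: c => c [x e]; exists x; exact: eq_exist. Qed.

Lemma iso_classes_map1 (X : simplicial SET) : iso_classes_map (idm X) = id.
Proof.
by apply: funext => c; have [x ->] := to_class_surj c; rewrite iso_classes_mapE.
Qed.

Lemma iso_classes_mapM (X Y Z : simplicial SET) (g : hom Y Z) (f : hom X Y) :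
  iso_classes_map (g ∘ f) = fun c => iso_classes_map g (iso_classes_map f c).
Proof.
by apply: funext => c; have [x ->] := to_class_surj c; rewrite !iso_classes_mapE.
Qed.

Definition iso_classes_functor : functor (simplicial SET) SET :=
  @Functor (simplicial SET) SET iso_classes iso_classes_map
    iso_classes_map1 iso_classes_mapM.

(** The discrete category on a set has a constant nerve. *)
Definition constant (J C : category) (x : C) : functor J C :=
  @Functor J C (fun _ => x) (fun _ _ _ => idm x)
    (fun _ => erefl) (fun _ _ _ _ _ => esym (comp1m (idm x))).

Lemma constant_natural (J C : category) (x y : C) (f : hom x y) (i j : J)
    (a : hom i j) : f ∘ fmap (constant J x) a = fmap (constant J y) a ∘ f.
Proof. by rewrite /= comp1m compm1. Qed.

Definition constant_map (J C : category) (x y : C) (f : hom x y) :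
  nattrans (constant J x) (constant J y) :=
  @NatTrans J C (constant J x) (constant J y) (fun _ => f)
    (constant_natural f).

Section Constant.
Variables J C : category.
Let K : category := functor_category J C.

Lemma constant_map1 (x : C) : constant_map J (idm x) = idm (constant J x : K).
Proof. exact: nattrans_eq. Qed.

Lemma constant_mapM (x y z : C) (g : hom y z) (f : hom x y) :
  constant_map J (g ∘ f) = (constant_map J g : @hom K _ _) ∘ constant_map J f.
Proof. exact: nattrans_eq. Qed.

Definition constant_functor : functor C K :=
  @Functor C K (fun x => constant J x) (@constant_map J C)
    constant_map1 constant_mapM.
End Constant.

(** [pF n] is p^(n+1) and [dF n] is d^(n+1). Both concern the last, that is
    the innermost, direction, so they are applied levelwise in the others:
    p^(n+1)(X)_s = p^(n)(X_s). *)
Fixpoint pF (n : nat) : functor (mSet n.+1) (mSet n) :=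
  match n with
  | 0 => iso_classes_functor
  | n'.+1 => postcomp _ (pF n')
  end.

Fixpoint dF (n : nat) : functor (mSet n) (mSet n.+1) :=
  match n with
  | 0 => constant_functor (opposite Delta) SET
  | n'.+1 => postcomp _ (dF n')
  end.

(** The composites p^(1) ... p^(n) and d^(n) ... d^(1). *)
Fixpoint pall (n : nat) : functor (mSet n) SET :=
  match n with
  | 0 => idf SET
  | n'.+1 => compf (pall n') (pF n')
  end.

Fixpoint dall (n : nat) : functor SET (mSet n) :=
  match n with
  | 0 => idf SET
  | n'.+1 => compf (dF n') (dall n')
  end.

(** [hd X] means that [X] lies in Cat^n_hd. *)
Fixpoint hd (n : nat) : mSet n -> Prop :=
  match n return mSet n -> Prop with
  | 0 => fun _ => True
  | n'.+1 => fun X =>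
      [/\ segal (@mlim n') X,
          forall s, hd (level X s)
        & match n' return (mSet n' -> Prop) -> mSet n'.+1 -> Prop with
          | 0 => fun _ X => equivalence_relation_category X
          | m.+1 => fun hd_pred X => hd_pred (pF m.+1 X)
          end (@hd n') X]
  end.

Definition Cat_hd (n : nat) : category := full_subcategory (@hd n).

Definition HdOb (n : nat) (X : mSet n) (h : hd X) : Cat_hd n := FullOb h.

Lemma hd_pF n (X : mSet n.+1) : hd X -> hd (pF n X).
Proof. by case: n X => [|n] X; [|case=> _ _]. Qed.

Lemma hd_level n (X : mSet n.+1) s : hd X -> hd (level X s).
Proof. by case=> _ hX _; exact: hX. Qed.

Definition hd_p n (X : Cat_hd n.+1) : Cat_hd n := HdOb (hd_pF (full_valP X)).

Definition hd_lvl n (X : Cat_hd n.+1) s : Cat_hd n :=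
  HdOb (hd_level s (full_valP X)).

(** The vertices of a simplex of a groupoid are all isomorphic; we take the
    class of the first one. *)
Definition gamma1_fun (X : simplicial SET) s (x : level X s) : iso_classes X :=
  to_class (simpl_map X (vertex ord0) x).

Lemma simpl_mapM (X : simplicial SET) m n k (b : monotone n k)
    (a : monotone m n) (x : level X k) :
  simpl_map X a (simpl_map X b x) = simpl_map X (mono_comp b a) x.
Proof. by rewrite /simpl_map (fmapM (X : functor _ _)). Qed.

Lemma equiv_rel (X : Cat_hd 1) : equivalence_relation_category (full_val X).
Proof. by case: X => X []. Qed.

Lemma gamma1_face (X : simplicial SET) (h : equivalence_relation_category X)
    m n (a : monotone m n) (x : level X n) :
  gamma1_fun (simpl_map X a x) = gamma1_fun x.
Proof.
rewrite /gamma1_fun; apply/esym/to_class_eq/rst_step.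
exists (simpl_map X (@arrow n ord0 (sval a ord0) isT) x).
by split; last exact: h.1; rewrite /src /tgt !simpl_mapM;
  congr (simpl_map X _ x); apply: monotone_eq.
Qed.

Section Gamma1.
Variables (X : simplicial SET) (h : equivalence_relation_category X).
Let dpX : simplicial SET :=
  constant (opposite Delta) (iso_classes X : SET).

Lemma gamma1_natural (m n : opposite Delta) (a : hom m n) :
  (@gamma1_fun X n : hom _ (level dpX n)) ∘ fmap (X : functor _ _) a =
  fmap (dpX : functor _ _) a ∘ (@gamma1_fun X m : hom _ (level dpX m)).
Proof. by apply: funext => x; exact: gamma1_face. Qed.

Definition gamma1 : hom X dpX :=
  @NatTrans _ _ (X : functor _ _) (dpX : functor _ _) (@gamma1_fun X)
    gamma1_natural.
End Gamma1.

(** The functor d^(n+1) p^(n+1). *)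
Definition dp (n : nat) : functor (Cat_hd n.+1) (mSet n.+1) :=
  compf (dF n) (compf (pF n) (inclusion _)).

Lemma gamma1_nat (X Y : Cat_hd 1) (f : hom X Y) :
  gamma1 (equiv_rel Y) ∘ f = fmap (dp 0) f ∘ gamma1 (equiv_rel X).
Proof.
apply: nattrans_eq => s; apply: funext => x.
rewrite /= /gamma1_fun iso_classes_mapE level_map_set //.
Qed.

Section GammaStep.
Variables (n : nat) (g : nattrans (inclusion (@hd n.+1)) (dp n)).

Lemma gammaS_natural (X : Cat_hd n.+2) (i j : opposite Delta) (a : hom i j) :
  g (hd_lvl X j) ∘ fmap (full_val X : functor _ _) a =
  fmap (dp n.+1 X : functor _ _) a ∘ g (hd_lvl X i).
Proof.
exact: (@natural _ _ _ _ g (hd_lvl X i) (hd_lvl X j) (fmap (full_val X : functor _ _) a)).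
Qed.

Definition gammaS_comp (X : Cat_hd n.+2) : hom (full_val X) (dp n.+1 X) :=
  @NatTrans _ _ (full_val X : functor _ _) (dp n.+1 X : functor _ _)
    (fun s => g (hd_lvl X s)) (@gammaS_natural X).

Lemma gammaS_nat (X Y : Cat_hd n.+2) (f : hom X Y) :
  gammaS_comp Y ∘ f = fmap (dp n.+1) f ∘ gammaS_comp X.
Proof.
apply: nattrans_eq => s.
exact: (@natural _ _ _ _ g (hd_lvl X s) (hd_lvl Y s) (level_map f s)).
Qed.

Definition gammaS : nattrans (inclusion (@hd n.+2)) (dp n.+1) :=
  @NatTrans _ _ (inclusion (@hd n.+2)) (dp n.+1) gammaS_comp gammaS_nat.
End GammaStep.

(** [gamma n X] is gamma^(n+1) : X -> d^(n+1) p^(n+1) X. *)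
Fixpoint gamma (n : nat) : nattrans (inclusion (@hd n.+1)) (dp n) :=
  match n with
  | 0 => @NatTrans _ _ (inclusion (@hd 1)) (dp 0)
           (fun X => gamma1 (equiv_rel X)) gamma1_nat
  | n'.+1 => gammaS (gamma n')
  end.

(** The functor X |-> X^d. *)
Definition disc (n : nat) : functor (Cat_hd n) (mSet n) :=
  compf (dall n) (compf (pall n) (inclusion _)).

Section GammaAllStep.
Variables (n : nat) (g : nattrans (inclusion (@hd n)) (disc n)).

Definition gamma_allS_comp (X : Cat_hd n.+1) :
  hom (full_val X) (disc n.+1 X) := fmap (dF n) (g (hd_p X)) ∘ gamma n X.

Lemma gamma_allS_nat (X Y : Cat_hd n.+1) (f : hom X Y) :
  gamma_allS_comp Y ∘ f = fmap (disc n.+1) f ∘ gamma_allS_comp X.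
Proof.
rewrite /gamma_allS_comp -compA (@natural _ _ _ _ (gamma n) X Y f) !compA.
congr ccomp.
have e := @natural _ _ _ _ g (hd_p X) (hd_p Y) (fmap (pF n) f).
apply: etrans (esym (fmapM (dF n) _ _)) _.
exact: etrans (congr1 (@fmap _ _ (dF n) _ _) e) (fmapM (dF n) _ _).
Qed.

Definition gamma_allS : nattrans (inclusion (@hd n.+1)) (disc n.+1) :=
  @NatTrans _ _ (inclusion (@hd n.+1)) (disc n.+1) gamma_allS_comp
    gamma_allS_nat.
End GammaAllStep.

(** [gamma_all n X] is gamma_(n) : X -> X^d. *)
Fixpoint gamma_all (n : nat) : nattrans (inclusion (@hd n)) (disc n) :=
  match n with
  | 0 => @NatTrans _ _ (inclusion (@hd 0)) (disc 0)
           (fun X => idm (full_val X)) (fun _ _ _ => erefl)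
  | n'.+1 => gamma_allS (gamma_all n')
  end.

Section Fibre.
Variable n : nat.
Let limC := @mlim n.

(** The map (d_0,d_1). *)
Definition d0d1 (X : mSet n.+1) :
  hom (level X 1) (product limC (level X 0) (level X 0)) :=
  pairing limC (tgt X) (src X).

(** The set underlying (X_0)^d *)
Definition disc_set (X : Cat_hd n.+1) : SET := pall n (level (full_val X) 0).

Definition disc_set_map (X Y : Cat_hd n.+1) (f : hom X Y) :
  hom (disc_set X) (disc_set Y) := fmap (pall n) (level_map f 0).

Definition endpoints (X : Cat_hd n.+1) :
  hom (level (full_val X) 1)
      (product limC (disc n (hd_lvl X 0)) (disc n (hd_lvl X 0))) :=
  prod_map limC (gamma_all n (hd_lvl X 0)) (gamma_all n (hd_lvl X 0))
    ∘ d0d1 (full_val X).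

(** An element of [A] as a point of the discrete n-fold category on [A]. *)
Definition element (A : SET) (a : A) : hom (dall n unit) (dall n A) :=
  fmap (dall n) ((fun _ => a) : hom (unit : SET) A).

Definition element_pair (X : Cat_hd n.+1) (a b : disc_set X) :
  hom (dall n unit)
      (product limC (disc n (hd_lvl X 0)) (disc n (hd_lvl X 0))) :=
  pairing limC (element a) (element b).

(** X(a,b) *)
Definition fibre (X : Cat_hd n.+1) (a b : disc_set X) : mSet n :=
  pullback limC (endpoints X) (element_pair a b).

Lemma endpoints_natural (X Y : Cat_hd n.+1) (f : hom X Y) :
  endpoints Y ∘ level_map f 1 =
  prod_map limC (fmap (dall n) (disc_set_map f)) (fmap (dall n) (disc_set_map f))
    ∘ endpoints X.
Proof.
have e : gamma_all n (hd_lvl Y 0) ∘ level_map f 0 =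
    fmap (dall n) (disc_set_map f) ∘ gamma_all n (hd_lvl X 0).
  exact: (@natural _ _ _ _ (gamma_all n) (hd_lvl X 0) (hd_lvl Y 0) (level_map f 0)).
rewrite /endpoints /d0d1 !prod_map_pairing pairing_comp -!compA.
by rewrite /tgt /src -!level_map_natural !compA e.
Qed.

Lemma element_map (A B : SET) (f : hom A B) (a : A) :
  fmap (dall n) f ∘ element a = element (f a).
Proof. by rewrite /element -fmapM. Qed.

Lemma fibre_map_subproof (X Y : Cat_hd n.+1) (f : hom X Y) (a b : disc_set X) :
  endpoints Y ∘ (level_map f 1 ∘ pb1 limC (endpoints X) (element_pair a b)) =
  element_pair (disc_set_map f a) (disc_set_map f b)
    ∘ pb2 limC (endpoints X) (element_pair a b).
Proof.
rewrite compA endpoints_natural -compA pbP compA; congr ccomp.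
by rewrite /element_pair prod_map_pairing !element_map.
Qed.

(** f(a,b) : X(a,b) -> Y(fa,fb) *)
Definition fibre_map (X Y : Cat_hd n.+1) (f : hom X Y) (a b : disc_set X) :
  hom (fibre a b) (fibre (disc_set_map f a) (disc_set_map f b)) :=
  pb_lift limC (fibre_map_subproof f a b).
End Fibre.

(** Natural isomorphism of functors between categories, in terms of nerves. *)
Definition naturally_isomorphic (X Y : simplicial SET) (f g : hom X Y) : Prop :=
  exists t : level X 0 -> level Y 1,
    (forall x, [/\ src Y (t x) = level_map f 0 x,
                   tgt Y (t x) = level_map g 0 x & invertible (t x)]) /\
    (forall u : level X 1, exists w,
       is_composite (level_map f 1 u) (t (tgt X u)) w /\
       is_composite (t (src X u)) (level_map g 1 u) w).

Definition equivalence_of_categories (X Y : simplicial SET) (f : hom X Y) :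
    Prop :=
  exists g : hom Y X, naturally_isomorphic (g ∘ f) (idm X) /\
                      naturally_isomorphic (f ∘ g) (idm Y).

(** [nequiv n f] means that [f] is an (n+1)-equivalence. For X in Cat^(n+2)_hd
    the fibres X(a,b) always lie in Cat^(n+1)_hd, being unions of components
    of X_1; the membership is asserted here because an (n+1)-equivalence is by
    definition a map of Cat^(n+1)_hd. *)
Fixpoint nequiv (n : nat) : forall X Y : Cat_hd n.+1, hom X Y -> Prop :=
  match n return forall X Y : Cat_hd n.+1, hom X Y -> Prop with
  | 0 => fun X Y f => @equivalence_of_categories (full_val X) (full_val Y) f
  | n'.+1 => fun X Y f =>
      (forall a b : disc_set X,
        exists (hX : hd (fibre a b))
               (hY : hd (fibre (disc_set_map f a) (disc_set_map f b))),
          @nequiv n' (HdOb hX) (HdOb hY) (fibre_map f a b)) /\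
      @nequiv n' (hd_p X) (hd_p Y) (fmap (pF n'.+1) f)
  end.

(* Main.v *)
From Stdlib Require Import Relation_Operators.
From mathcomp Require Import all_boot boolp.
Require Import Defs.

Set Implicit Arguments.
Unset Strict Implicit.
Unset Printing Implicit Defensive.

(** A map f of homotopically discrete n-fold categories is an n-equivalence if
    and only if the map of sets p^(1)...p^(n) f is bijective ([nequivP]). The
    2-out-of-3 property is then that of bijections, and it only remains to see
    that gamma^(n) and gamma_(n) become bijective after p^(1)...p^(n)
    ([pall_gamma_iso], [pall_gamma_all_iso]) and that their targets are
    homotopically discrete ([hd_dF], [hd_dall]).

    For n = 1 the criterion says that a functor between equivalence relations is
    an equivalence exactly when it is bijective on isomorphism classes
    ([equivalence_iso_classes]). In the inductive step the condition on p^(n) f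
    is equivalent to the bijectivity of p^(1)...p^(n) f by the induction
    hypothesis, so what must be shown is that this bijectivity implies the
    condition on the fibres ([fibre_map_iso]). The simplicial set
    s |-> p^(1)...p^(n-1)(X_s) is an equivalence relation, obtained from X by
    applying p in all directions but the first, and its set of classes is
    p^(1)...p^(n)(X) ([obj_class_edge], [pall_edge_eq]). The fibre X(a,b) is the
    union of the components of X_1 that are edges between a and b in this
    relation ([fibre_components]). Hence it has at most one component, and it
    has one if and only if a and b have the same image in p^(1)...p^(n)(X). A
    map that is injective on p^(1)...p^(n)(X) therefore induces a bijection on
    the sets of components of the fibres.

    An n-equivalence has to be a map of homotopically discrete objects, so the
    fibres must be shown to be such. This follows from the general fact that a
    union of components of a homotopically discrete object is homotopically
    discrete ([components_hd]). Both this and the Segal conditions are checked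
    on elements: an n-simplicial set is evaluated at multi-indices ([mev]), at
    which limits are computed as in sets ([mlim_ev_exists],
    [mlim_ev_unique]), and an equivalence relation is recognised as the nerve of
    a kernel pair ([kernel_pair_nerve]), whose simplices are families of
    vertices. *)

(** * Isomorphisms *)

Section Isomorphisms.
Variable C : category.

Lemma iso_comp (x y z : C) (f : hom x y) (g : hom y z) :
  is_iso f -> is_iso g -> is_iso (g ∘ f).
Proof.
move=> [f' [f'f ff']] [g' [g'g gg']]; exists (f' ∘ g'); split.
  by rewrite compA -(compA f') g'g compm1.
by rewrite compA -(compA g) ff' compm1.
Qed.

Lemma iso_cancel_right (x y z : C) (f : hom x y) (g : hom y z) :
  is_iso f -> is_iso (g ∘ f) -> is_iso g.
Proof.
move=> [f' [f'f ff']] gf_iso; rewrite -[g]compm1 -ff' compA.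
by apply: iso_comp gf_iso; exists f.
Qed.

Lemma iso_cancel_left (x y z : C) (f : hom x y) (g : hom y z) :
  is_iso g -> is_iso (g ∘ f) -> is_iso f.
Proof.
move=> [g' [g'g gg']] gf_iso; rewrite -[f]comp1m -g'g -compA.
by apply: iso_comp gf_iso _; exists g.
Qed.

Lemma iso_fmap (D : category) (F : functor C D) (x y : C) (f : hom x y) :
  is_iso f -> is_iso (fmap F f).
Proof.
by case=> g [gf fg]; exists (fmap F g); rewrite -!fmapM gf fg !fmap1.
Qed.
End Isomorphisms.

Lemma iso_SET (A B : SET) (f : hom A B) :
  is_iso f <-> injective f /\ forall b, exists a, f a = b.
Proof.
split=> [[g [gf fg]]|[f_inj f_surj]].
  split=> [a a' e|b].
    by rewrite -[a](congr1 (@^~ a) gf) -[a'](congr1 (@^~ a') gf) /= e.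
  by exists (g b); exact: (congr1 (@^~ b) fg).
have [g fg] := choice f_surj.
exists (g : hom B A); split; [apply: funext => a|exact: funext].
by apply: f_inj; rewrite /= fg.
Qed.

(** The levelwise inverses are chosen; they are natural because inverses are
    unique. *)
Lemma iso_simplicial (C : category) (X Y : simplicial C) (f : hom X Y) :
  (forall s, is_iso (level_map f s)) -> is_iso f.
Proof.
move=> f_iso; pose g s := sval (cid (f_iso s)).
have gf s : g s ∘ level_map f s = idm _ := (svalP (cid (f_iso s))).1.
have fg s : level_map f s ∘ g s = idm _ := (svalP (cid (f_iso s))).2.
have g_nat (m n : opposite Delta) (a : hom m n) :
    g n ∘ fmap (Y : functor _ _) a = fmap (X : functor _ _) a ∘ g m.
  rewrite -[LHS]compm1 -(fg m) compA -(compA (g n)).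
  rewrite -(natural (f : nattrans _ _) a).
  by rewrite (compA (g n)) gf comp1m.
exists (@NatTrans _ _ (Y : functor _ _) (X : functor _ _) g g_nat).
by split; apply: nattrans_eq => s; [exact: gf | exact: fg].
Qed.

(** * Evaluation of multisimplicial sets *)

(** The objects of the n-fold product of [Delta] with itself. *)
Fixpoint mindex (n : nat) : Type :=
  match n with 0 => unit | n'.+1 => (nat * mindex n')%type end.

Definition evaluation (C : category) (s : nat) : functor (simplicial C) C :=
  @Functor (simplicial C) C (fun X => level X s) (fun X Y f => level_map f s)
    (fun _ => erefl) (fun _ _ _ _ _ => erefl).

(** The set X(k_1, ..., k_n), as a functor of X. *)
Fixpoint mev (n : nat) : mindex n -> functor (mSet n) SET :=
  match n with
  | 0 => fun _ => idf SET
  | n'.+1 => fun k => compf (mev k.2) (evaluation (mSet n') k.1)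
  end.

Lemma mev_comp n (k : mindex n) (X Y Z : mSet n) (g : hom Y Z) (f : hom X Y)
    (x : mev k X) :
  fmap (mev k) (g ∘ f) x = fmap (mev k) g (fmap (mev k) f x).
Proof. by rewrite fmapM. Qed.

(** Limits of n-simplicial sets are computed pointwise: an element of the limit
    at a multi-index amounts to a compatible family of elements there. This
    lemma gives existence and the next one uniqueness. *)
Lemma mlim_ev_exists n (D : diagram (mSet n)) (k : mindex n)
    (x : forall v, mev k (dob D v)) :
  (forall e, fmap (mev k) (dmap D e) (x (dsrc e)) = x (dtgt e)) ->
  exists l : mev k (mlim D : mSet n),
    forall v, fmap (mev k) (proj (mlim D) v) l = x v.
Proof.
elim: n => [|n IHn] in D k x *; first by move=> xP; exists (exist _ x xP).
exact: (IHn (ev_diagram D k.1) k.2 x).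
Qed.

Lemma mlim_ev_unique n (D : diagram (mSet n)) (k : mindex n)
    (l l' : mev k (mlim D : mSet n)) :
  (forall v, fmap (mev k) (proj (mlim D) v) l =
             fmap (mev k) (proj (mlim D) v) l') -> l = l'.
Proof.
elim: n => [|n IHn] in D k l l' *.
  case: l l' => [l lP] [l' l'P] /= e; apply: eq_exist.
  exact: functional_extensionality_dep.
exact: (IHn (ev_diagram D k.1) k.2 l l').
Qed.

Lemma iso_of_mev n (X Y : mSet n) (f : hom X Y) :
  (forall k, is_iso (fmap (mev k) f)) -> is_iso f.
Proof.
elim: n => [|n IHn] in X Y f *; first by move=> /(_ tt).
move=> f_iso; apply: iso_simplicial => s.
by apply: IHn => k; exact: (f_iso (s, k)).
Qed.

(** * The Segal condition, elementwise *)

Definition chain (S : simplicial SET) s (e : 'I_s -> level S 1) : Prop :=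
  forall i j : 'I_s, j = i.+1 :> nat -> tgt S (e i) = src S (e j).

(** The Segal condition of a simplicial set, with the redundant vertices of the
    iterated fibre product left out. *)
Definition chains_fill (S : simplicial SET) : Prop :=
  forall s, 2 <= s ->
    (forall e : 'I_s -> level S 1, chain e ->
       exists z : level S s, forall i, simpl_map S (spine i) z = e i) /\
    (forall z z' : level S s,
       (forall i, simpl_map S (spine i) z = simpl_map S (spine i) z') -> z = z').

(** The simplicial set obtained from X by freezing all directions but the first
    one. *)
Definition row n (X : mSet n.+1) (k : mindex n) : simplicial SET :=
  compf (mev k) (X : functor _ _).

Lemma src_spine (S : simplicial SET) s (i : 'I_s) (z : level S s) :
  src S (simpl_map S (spine i) z) = simpl_map S (vertex (widen_ord (leqnSn s) i)) z.
Proof.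
by rewrite /src simpl_mapM; congr (simpl_map S _ z); exact: monotone_eq.
Qed.

Lemma tgt_spine (S : simplicial SET) s (i : 'I_s) (z : level S s) :
  tgt S (simpl_map S (spine i) z) = simpl_map S (vertex (lift ord0 i)) z.
Proof.
by rewrite /tgt simpl_mapM; congr (simpl_map S _ z); exact: monotone_eq.
Qed.

(** Every vertex of a nonempty spine is the source of its first edge or the
    target of some edge. *)
Lemma vertex_ind s (P : 'I_s.+2 -> Prop) :
  P (widen_ord (leqnSn s.+1) ord0) -> (forall i : 'I_s.+1, P (lift ord0 i)) ->
  forall j, P j.
Proof.
move=> P0 PS j; case: (unliftP ord0 j) => [i -> //|->].
by rewrite (_ : ord0 = widen_ord (leqnSn s.+1) ord0) //; exact: val_inj.
Qed.

(** Limits and isomorphisms are both detected at each multi-index, so that the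
    Segal condition in the first direction is a condition on rows. *)
Lemma segalE n (X : mSet n.+1) :
  segal (@mlim n) X <-> forall k, chains_fill (row X k).
Proof.
have ev_segal s (k : mindex n) (v : node (segal_diagram X s)) z :
    fmap (mev k) (proj (mlim (segal_diagram X s)) v)
      (fmap (mev k) (segal_map (@mlim n) X s) z) =
    fmap (mev k) (segal_leg v) z.
  by rewrite -mev_comp lim_liftP.
split=> [X_segal k s s2|fill s s2].
- have [inj surj] := (iso_SET _).1 (iso_fmap (mev k) (X_segal s s2)).
  case: s s2 => // s s2 in inj surj *.
  split=> [e e_chain|z z' zz'].
    (* The element of the iterated fibre product given by a chain: its vertices
       are the targets of the edges, preceded by the source of the first. *)
    pose x (v : node (segal_diagram X s.+1)) : mev k (dob (segal_diagram X s.+1) v) :=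
      match v with
      | inl i => e i
      | inr j => if unlift ord0 j is Some i then tgt (row X k) (e i)
                 else src (row X k) (e ord0)
      end.
    have [|l lP] := @mlim_ev_exists n (segal_diagram X s.+1) k x.
      case=> [[] i] /=; first by rewrite liftK.
      case: (unliftP ord0 (widen_ord _ i)) => [j|] /(congr1 val) /= ij.
        by apply/esym/e_chain; rewrite ij.
      by rewrite (_ : i = ord0) //; exact: val_inj.
    have [z zP] := surj l; exists z => i.
    by move: (lP (inl i)); rewrite -zP ev_segal.
  apply: inj; apply: mlim_ev_unique => v; rewrite !ev_segal.
  case: v => [i|j]; first exact: zz'.
  elim/vertex_ind: j => [|i].
    have := congr1 (src (row X k)) (zz' ord0).
    by rewrite !src_spine.
  by have := congr1 (tgt (row X k)) (zz' i); rewrite !tgt_spine.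
- apply: iso_of_mev => k; apply/iso_SET.
  have [ex uniq] := fill k s s2.
  split=> [z z' zz'|l].
    apply: uniq => i.
    by apply: etrans (esym (ev_segal s k (inl i) z)) _; rewrite zz' ev_segal.
  pose e i := fmap (mev k) (proj (mlim (segal_diagram X s)) (inl i)) l.
  have lP (d : edge (segal_diagram X s)) :
      fmap (mev k) (dmap (segal_diagram X s) d) (e d.2) =
      fmap (mev k) (proj (mlim (segal_diagram X s)) (dtgt d)) l.
    rewrite -(legP (proj (mlim (segal_diagram X s))) d).
    exact: (esym (mev_comp _ _ _)).
  have [|z zP] := ex e.
    move=> i j ij; have := lP (true, i); have := lP (false, j) => /= ej ei.
    apply: etrans ei _; apply: etrans _ (esym ej).
    by rewrite (_ : widen_ord _ j = lift ord0 i) //; exact: val_inj.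
  exists z; apply: mlim_ev_unique => v; rewrite ev_segal.
  case: v => [i|j]; first exact: zP.
  case: s s2 => // s s2 in ex uniq l e lP ev_segal z zP j *.
  elim/vertex_ind: j => [|i].
    apply: etrans _ (lP (false, ord0)); rewrite -zP.
    exact: (esym (@src_spine (row X k) s.+1 ord0 z)).
  apply: etrans _ (lP (true, i)); rewrite -zP.
  exact: (esym (@tgt_spine (row X k) s.+1 i z)).
Qed.

(** * Equivalence relations as nerves of kernel pairs *)

(** The nerve of the kernel pair of [c]: an s-simplex is the same as a family
    of s+1 vertices on which [c] is constant. *)
Definition kernel_pair_nerve (S : simplicial SET) (A : Type)
    (c : level S 0 -> A) : Prop :=
  [/\ forall s (z : level S s) i j,
        c (simpl_map S (vertex i) z) = c (simpl_map S (vertex j) z),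
      forall s (x : 'I_s.+1 -> level S 0), (forall i j, c (x i) = c (x j)) ->
        exists z : level S s, forall i, simpl_map S (vertex i) z = x i
    & forall s (z z' : level S s),
        (forall i, simpl_map S (vertex i) z = simpl_map S (vertex i) z') ->
        z = z'].

Lemma simpl_map_id (S : simplicial SET) m (a : monotone m m) (x : level S m) :
  (forall i, sval a i = i) -> simpl_map S a x = x.
Proof.
move=> a_id; rewrite (_ : a = mono_id m); last exact: monotone_eq.
exact: (congr1 (@^~ x) (fmap1 (S : functor _ _) m)).
Qed.

Lemma vertex0_id (S : simplicial SET) (x : level S 0) (i : 'I_1) :
  simpl_map S (vertex i) x = x.
Proof. by apply: simpl_map_id => j; rewrite /= !ord1. Qed.

Lemma edge_vertices (S : simplicial SET) (u : level S 1) (i : 'I_2) :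
  simpl_map S (vertex i) u = if i == ord0 then src S u else tgt S u.
Proof.
by rewrite /src /tgt; case: i => [[|[|//]] lti] /=;
  congr (simpl_map S _ u); apply: monotone_eq => j; exact: val_inj.
Qed.

Lemma edge_faces (S : simplicial SET) n (z : level S n) (i j : 'I_n.+1)
    (ij : i <= j) :
  (src S (simpl_map S (arrow ij) z) = simpl_map S (vertex i) z) *
  (tgt S (simpl_map S (arrow ij) z) = simpl_map S (vertex j) z).
Proof.
by rewrite /src /tgt !simpl_mapM; split;
  congr (simpl_map S _ z); exact: monotone_eq.
Qed.

Lemma identity_faces (S : simplicial SET) (x : level S 0) :
  (src S (identity x) = x) * (tgt S (identity x) = x).
Proof.
by rewrite /src /tgt /identity !simpl_mapM; split;
  apply: simpl_map_id => i; rewrite [RHS]ord1.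
Qed.

Lemma composite_faces (S : simplicial SET) (u v w : level S 1) :
  is_composite u v w ->
  [/\ src S w = src S u, tgt S w = tgt S v & tgt S u = src S v].
Proof. by case=> t [<- <- <-]; rewrite !edge_faces. Qed.

(** An equivalence relation, viewed as a category, is the kernel pair of the
    projection to its classes. *)
Section EquivalenceRelation.
Variables (S : simplicial SET) (S_fill : chains_fill S)
  (S_eqrel : equivalence_relation_category S).

Lemma edge_trans (u v : level S 1) : tgt S u = src S v ->
  exists w, src S w = src S u /\ tgt S w = tgt S v.
Proof.
move=> uv; have [ex _] := S_fill (leqnn 2).
have [|z zP] := ex (fun i : 'I_2 => if i == ord0 then u else v).
  by move=> [[|[|//]] ?] [[|[|//]] ?].
exists (simpl_map S (@arrow 2 ord0 ord_max isT) z); rewrite !edge_faces.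
have := zP ord0; have := zP ord_max => /= <- <-.
rewrite src_spine tgt_spine; split; congr (simpl_map S _ z);
  by apply: monotone_eq => i; exact: val_inj.
Qed.

(** All edges are invertible and consecutive edges have a composite, so that
    being joined by an edge is already an equivalence relation. *)
Lemma iso_class_edge (x y : level S 0) :
  iso_class x y -> exists u, src S u = x /\ tgt S u = y.
Proof.
elim=> {x y} [x y [u [<- <- _]]|x|x y _ [u [<- <-]]|x y z _ [u [<- uy]] _ [v [vy <-]]].
- by exists u.
- by exists (identity x); rewrite !identity_faces.
- have [v [/composite_faces[_ e1 e2] _]] := S_eqrel.1 u.
  by exists v; rewrite -e2 -e1 identity_faces.
- by apply: edge_trans; rewrite uy.
Qed.

Lemma to_class_edge (x y : level S 0) :
  to_class x = to_class y -> exists u, src S u = x /\ tgt S u = y.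
Proof.
move=> /(congr1 sval) /= e; apply: iso_class_edge.
by rewrite e; exact: rst_refl.
Qed.

(** The edges between consecutive vertices of a family inside one class exist
    and are unique; the Segal condition assembles them into one simplex. *)
Lemma eqrel_kernel_pair : kernel_pair_nerve (@to_class S).
Proof.
split=> [s z i j|s x xc|s z z' zz'].
- have vE l : to_class (simpl_map S (vertex l) z) = gamma1_fun z.
    rewrite -(gamma1_face S_eqrel (vertex l)) /gamma1_fun.
    by rewrite vertex0_id.
  by rewrite !vE.
- case: s x xc => [|[|s]] x xc.
  + by exists (x ord0) => i; rewrite vertex0_id ord1.
  + have [u [us ut]] := to_class_edge (xc ord0 ord_max).
    exists u => i; rewrite edge_vertices us ut.
    by case: i => [[|[|//]] ?] /=; congr x; exact: val_inj.
  + have := fun i : 'I_s.+2 => to_class_edge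
      (xc (widen_ord (leqnSn s.+2) i) (lift ord0 i)).
    move=> /choice[e eP].
    have [ex _] := @S_fill s.+2 isT; have [|z zP] := ex e.
      move=> i j ij; rewrite (eP i).2 (eP j).1; congr x; exact: val_inj.
    exists z; elim/vertex_ind => [|i].
      by rewrite -src_spine zP (eP ord0).1.
    by rewrite -tgt_spine zP (eP i).2.
- case: s z z' zz' => [|[|s]] z z' zz'.
  + by have := zz' ord0; rewrite !vertex0_id.
  + by apply: S_eqrel.2; [have := zz' ord0 | have := zz' ord_max];
      rewrite !edge_vertices.
  + have [_ uniq] := @S_fill s.+2 isT; apply: uniq => i.
    by apply: S_eqrel.2; rewrite ?src_spine ?tgt_spine.
Qed.
End EquivalenceRelation.

(** Conversely, the nerve of a kernel pair is an equivalence relation whose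
    classes are the fibres of the map. *)
Section KernelPair.
Variables (S : simplicial SET) (A : Type) (c : level S 0 -> A).
Hypothesis S_ker : kernel_pair_nerve c.

Lemma kernel_pair_edge_eq (u v : level S 1) :
  src S u = src S v -> tgt S u = tgt S v -> u = v.
Proof.
case: S_ker => _ _ inj eqs eqt.
by apply: inj => i; rewrite !edge_vertices eqs eqt.
Qed.

Lemma kernel_pair_edge (x y : level S 0) : c x = c y ->
  exists u, src S u = x /\ tgt S u = y.
Proof.
move=> xy; case: S_ker => _ ex _.
have [|u uP] := ex 1 (fun i : 'I_2 => if i == ord0 then x else y).
  by move=> i j; case: ifP; case: ifP; rewrite // xy.
exists u; have := uP ord0; have := uP ord_max.
by rewrite !edge_vertices.
Qed.

Lemma kernel_pair_src_tgt (u : level S 1) : c (src S u) = c (tgt S u).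
Proof. by case: S_ker => /(_ 1 u ord0 ord_max) + _ _; rewrite !edge_vertices. Qed.

Lemma kernel_pair_composite (u v w : level S 1) :
  src S w = src S u -> tgt S w = tgt S v -> tgt S u = src S v ->
  is_composite u v w.
Proof.
move=> wu wv uv; case: S_ker => _ ex _.
pose x (i : 'I_3) := if i == ord0 then src S u else
                     if i == ord_max then tgt S v else tgt S u.
have [|t tP] := ex 2 x.
  have xE i : c (x i) = c (src S u).
    rewrite /x; case: ifP => // _; case: ifP => _.
      by rewrite -kernel_pair_src_tgt -uv -kernel_pair_src_tgt.
    by rewrite -kernel_pair_src_tgt.
  by move=> i j; rewrite !xE.
exists t; split; apply: kernel_pair_edge_eq;
  by rewrite !edge_faces !tP /x /= ?uv ?wu ?wv.
Qed.

Lemma kernel_pair_invertible (u : level S 1) : invertible u.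
Proof.
have [v [vs vt]] := kernel_pair_edge (esym (kernel_pair_src_tgt u)).
by exists v; split; apply: kernel_pair_composite;
  rewrite ?identity_faces ?vs ?vt.
Qed.

(** The fibres of [c] are the isomorphism classes. *)
Lemma kernel_pair_to_class (x y : level S 0) :
  to_class x = to_class y <-> c x = c y.
Proof.
split=> [/(congr1 sval) /= e|].
  have : iso_class x y by rewrite e; exact: rst_refl.
  elim=> {x y e} [x y [u [<- <- _]]|x|x y _ <-|x y z _ -> _ <-] //.
  exact: kernel_pair_src_tgt.
case/kernel_pair_edge => u [<- <-].
apply/to_class_eq/rst_step; exists u; split=> //.
exact: kernel_pair_invertible.
Qed.

Lemma kernel_pair_chains_fill : chains_fill S.
Proof.
case: S_ker => const ex inj s s2; split=> [e e_chain|z z' zz'].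
- case: s => // s in s2 e e_chain *.
  pose x (j : 'I_s.+2) :=
    if unlift ord0 j is Some i then tgt S (e i) else src S (e ord0).
  have xl i : x (lift ord0 i) = tgt S (e i) by rewrite /x liftK.
  have xw i : x (widen_ord (leqnSn s.+1) i) = src S (e i).
    rewrite /x; case: (unliftP ord0 (widen_ord _ i)) => [j|] /(congr1 val) /= ij.
      exact: e_chain.
    by congr (src S (e _)); exact: val_inj.
  have xc i : c (x i) = c (src S (e ord0)).
    elim/vertex_ind: i => [|i]; first by rewrite xw.
    case: i => i lti; elim: i => [|i IHi] in lti *.
      by rewrite xl -kernel_pair_src_tgt; congr (c (src S (e _))); exact: val_inj.
    rewrite xl -kernel_pair_src_tgt -xw.
    rewrite -(IHi (ltnW lti)); congr (c (x _)); exact: val_inj.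
  have [|z zP] := ex s.+1 x; first by move=> i j; rewrite !xc.
  exists z => i; apply: kernel_pair_edge_eq.
    by rewrite src_spine zP xw.
  by rewrite tgt_spine zP xl.
- case: s => // s in s2 z z' zz' *.
  apply: inj; elim/vertex_ind => [|i]; first by rewrite -!src_spine zz'.
  by rewrite -!tgt_spine zz'.
Qed.
End KernelPair.

Lemma hd1_chains_fill (S : mSet 1) : hd S -> chains_fill S.
Proof. by case=> /segalE /(_ tt). Qed.

Lemma hd1_kernel_pair (S : mSet 1) : hd S -> kernel_pair_nerve (@to_class S).
Proof.
move=> S_hd; apply: eqrel_kernel_pair (hd1_chains_fill S_hd) _.
by case: S_hd.
Qed.

(** A criterion for homotopical discreteness that mentions neither composites
    nor inverses; it applies at once to unions of components and to constant
    simplicial sets. *)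
Lemma kernel_pair_hd1 (S : mSet 1) A (c : level S 0 -> A) :
  kernel_pair_nerve c -> hd S.
Proof.
move=> S_ker; split=> //.
  by apply/segalE => k; exact: kernel_pair_chains_fill S_ker.
by split; [exact: kernel_pair_invertible S_ker | exact: kernel_pair_edge_eq S_ker].
Qed.

(** * Equivalences between equivalence relations *)

Lemma to_class_isomorphic (X : simplicial SET) (x y : level X 0) :
  isomorphic x y -> to_class x = to_class y.
Proof. by move=> xy; apply/to_class_eq/rst_step. Qed.

Lemma naturally_isomorphic_classes (X Y : simplicial SET) (f g : hom X Y) :
  naturally_isomorphic f g -> iso_classes_map f = iso_classes_map g.
Proof.
case=> t [tP _]; apply: funext => c.
have [x ->] := to_class_surj c; rewrite !iso_classes_mapE.
apply: to_class_isomorphic; exists (t x).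
by have [-> -> ?] := tP x.
Qed.

(** In an equivalence relation naturality is automatic. *)
Lemma classes_naturally_isomorphic (X : simplicial SET) (Y : mSet 1)
    (f g : hom X Y) : hd Y ->
  (forall x, to_class (level_map f 0 x) = to_class (level_map g 0 x)) ->
  naturally_isomorphic f g.
Proof.
move=> /hd1_kernel_pair Y_ker fg.
have /choice[t tP] x := kernel_pair_edge Y_ker (fg x).
exists t; split=> [x|u].
  have [tx_src tx_tgt] := tP x.
  by split=> //; exact: kernel_pair_invertible Y_ker _.
have uE i := level_map_set f (vertex (i : 'I_2)) u.
have vE i := level_map_set g (vertex (i : 'I_2)) u.
have [|w [ws wt]] := @kernel_pair_edge _ _ _ Y_ker
    (level_map f 0 (src X u)) (level_map g 0 (tgt X u)).
  rewrite -fg /src /tgt !uE.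
  exact: (kernel_pair_src_tgt Y_ker (level_map f 1 u)).
exists w; split; apply: (kernel_pair_composite Y_ker); rewrite ?ws ?wt.
- exact: uE.
- by rewrite (tP _).2.
- by rewrite (tP _).1; exact: (esym (uE _)).
- by rewrite (tP _).1.
- exact: vE.
- by rewrite (tP _).2; exact: vE.
Qed.

(** A map of objects that respects classes extends to simplices, since these are
    the families of vertices inside one class. *)
Lemma kernel_pair_functor (X Y : mSet 1) (g0 : level Y 0 -> level X 0) :
  hd X -> hd Y ->
  (forall y y', to_class y = to_class y' -> to_class (g0 y) = to_class (g0 y')) ->
  exists g : hom Y X, forall y, level_map g 0 y = g0 y.
Proof.
move=> /hd1_kernel_pair[_ X_ex X_inj] /hd1_kernel_pair[Y_const _ _] g0_class.
have G_ex s (z : level Y s) : exists x : level X s,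
    forall i, simpl_map X (vertex i) x = g0 (simpl_map Y (vertex i) z).
  by apply: X_ex => i j; exact/g0_class/Y_const.
pose G s z := sval (cid (G_ex s z)).
have GP s z i : simpl_map X (vertex i) (G s z) = g0 (simpl_map Y (vertex i) z).
  exact: svalP (cid (G_ex s z)) i.
have G_nat (m n : opposite Delta) (a : hom m n) :
    (G n : hom (level Y n) (level X n)) ∘ fmap (Y : functor _ _) a =
    fmap (X : functor _ _) a ∘ (G m : hom (level Y m) (level X m)).
  apply: funext => z; apply: X_inj => i; apply: etrans (GP _ _ _) _.
  have vE (S : simplicial SET) (x : level S m) :
      simpl_map S (vertex i) (fmap (S : functor _ _) a x) =
      simpl_map S (vertex (sval a i)) x.
    apply: etrans (simpl_mapM _ _ _) _.
    by congr (simpl_map S _ x); exact: monotone_eq.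
  by rewrite (vE Y) (vE X) GP.
exists (@NatTrans _ _ (Y : functor _ _) (X : functor _ _) G G_nat) => y.
by have := GP 0 y ord0; rewrite !vertex0_id.
Qed.

(** A functor between equivalence relations is full as soon as it is injective
    on classes, and it is always faithful. A quasi-inverse is built by choosing,
    for each object of Y, an object of X mapped into its class. *)
Lemma equivalence_iso_classes (X Y : mSet 1) (f : hom X Y) : hd X -> hd Y ->
  equivalence_of_categories f <-> is_iso (fmap iso_classes_functor f).
Proof.
move=> X_hd Y_hd; split=> [[g [gf fg]]|/iso_SET[f_inj f_surj]].
  exists (fmap iso_classes_functor g).
  by split; rewrite -fmapM -fmap1; exact: naturally_isomorphic_classes.
have /choice[g0 g0P] y : exists x, to_class (level_map f 0 x) = to_class y.
  have [c] := f_surj (to_class y); have [x ->] := to_class_surj c.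
  by rewrite /= iso_classes_mapE; exists x.
have f_class x x' : to_class (level_map f 0 x) = to_class (level_map f 0 x') ->
    to_class x = to_class x'.
  by rewrite -!iso_classes_mapE => /f_inj.
have [|g gE] := @kernel_pair_functor X Y g0 X_hd Y_hd.
  by move=> y y' yy'; apply: f_class; rewrite !g0P.
exists g; split; apply: classes_naturally_isomorphic => // x.
  by apply: f_class; apply: etrans _ (g0P (level_map f 0 x)); rewrite -gE.
by apply: etrans _ (g0P x); rewrite -gE.
Qed.

(** * The set of components of a homotopically discrete n-fold category *)

(** The map p^(1)...p^(n)(X_0) -> p^(1)...p^(n+1)(X) that sends a component of
    the objects to its component in X. For n > 0 the functor p^(n+1) acts
    levelwise in the first direction, so that s |-> p^(1)...p^(n)(X_s) is
    s |-> p^(1)...p^(n-1)(Y_s) with Y := p^(n+1)(X); iterating this, [obj_class] is the map from the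
    objects of this simplicial set to their isomorphism classes. *)
Fixpoint obj_class (n : nat) : forall X : mSet n.+1,
    pall n (level X 0) -> pall n.+1 X :=
  match n return forall X : mSet n.+1, pall n (level X 0) -> pall n.+1 X with
  | 0 => fun X x => to_class x
  | n'.+1 => fun X x => obj_class (X := pF n'.+1 X) x
  end.

Lemma obj_class_map n (X Y : mSet n.+1) (f : hom X Y) (x : pall n (level X 0)) :
  fmap (pall n.+1) f (obj_class x) =
  obj_class (fmap (pall n) (level_map f 0) x).
Proof.
elim: n => [|n IHn] in X Y f x *; first exact: iso_classes_mapE.
exact: (IHn _ _ (fmap (pF n.+1) f)).
Qed.

(** If X is homotopically discrete then s |-> p^(1)...p^(n)(X_s) is an
    equivalence relation. The next lemma says that its edges are determined by
    their endpoints. *)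
Lemma obj_class_edge n (X : mSet n.+1) (x y : pall n (level X 0)) : hd X ->
  obj_class x = obj_class y <->
  exists u : pall n (level X 1),
    fmap (pall n) (src X) u = x /\ fmap (pall n) (tgt X) u = y.
Proof.
elim: n => [|n IHn] in X x y *; last by case=> _ _; exact: (IHn (pF n.+1 X)).
move=> /hd1_kernel_pair X_ker; split; first exact: (kernel_pair_edge X_ker).
by case=> u [<- <-]; exact: (kernel_pair_src_tgt X_ker u).
Qed.

Lemma pall_edge_eq n (X : mSet n.+1) (u v : pall n (level X 1)) : hd X ->
  fmap (pall n) (src X) u = fmap (pall n) (src X) v ->
  fmap (pall n) (tgt X) u = fmap (pall n) (tgt X) v -> u = v.
Proof.
elim: n => [|n IHn] in X u v *; last by case=> _ _; exact: (IHn (pF n.+1 X)).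
by move=> /hd1_kernel_pair X_ker; exact: (kernel_pair_edge_eq X_ker).
Qed.

(** For homotopically discrete X all vertices of a simplex are in the same
    component; the first one is a choice available for every X. *)
Definition first_vertex_class n (X : mSet n.+1) s (u : pall n (level X s)) :
  pall n.+1 X :=
  obj_class (fmap (pall n) (simpl_map X (vertex ord0)) u).

(** The component of X that contains a given element of X(k_1, ..., k_n). *)
Fixpoint class n : forall (X : mSet n) (k : mindex n), mev k X -> pall n X :=
  match n return forall (X : mSet n) (k : mindex n), mev k X -> pall n X with
  | 0 => fun X k x => x
  | n'.+1 => fun X k x =>
      first_vertex_class (class (X := level X k.1) (k := k.2) x)
  end.

Lemma first_vertex_class_map n (X Y : mSet n.+1) (f : hom X Y) s
    (u : pall n (level X s)) :
  fmap (pall n.+1) f (first_vertex_class u) =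
  first_vertex_class (fmap (pall n) (level_map f s) u).
Proof.
rewrite /first_vertex_class obj_class_map; congr obj_class.
have := congr1 (fun h => fmap (pall n) h u)
  (level_map_natural f (vertex (ord0 : 'I_s.+1))).
by rewrite !fmapM.
Qed.

Lemma class_map n (X Y : mSet n) (k : mindex n) (f : hom X Y) (x : mev k X) :
  fmap (pall n) f (class x) = class (fmap (mev k) f x).
Proof.
elim: n => [//|n IHn] in X Y k f x *.
rewrite /= -(IHn _ _ _ (level_map f k.1)).
exact: first_vertex_class_map.
Qed.

(** * Unions of components *)

(** The map i identifies W with the union of those components of Z that satisfy
    P. *)
Definition components n (W Z : mSet n) (i : hom W Z) (P : pall n Z -> Prop) :
    Prop :=
  forall k : mindex n, injective (fmap (mev k) i) /\
    forall z, P (class z) <-> exists w, fmap (mev k) i w = z.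

Lemma components_level n (W Z : mSet n.+1) (i : hom W Z) P s :
  components i P ->
  components (level_map i s) (fun u => P (first_vertex_class u)).
Proof. by move=> iP k; exact: (iP (s, k)). Qed.

(** A simplex all of whose vertices are in W has its class in P, hence lies in W
    itself. *)
Lemma components_kernel_pair (W Z : mSet 1) (i : hom W Z) P : components i P ->
  hd Z -> kernel_pair_nerve (fun w => to_class (level_map i 0 w)).
Proof.
move=> iP /hd1_kernel_pair[Z_const Z_ex Z_inj].
split=> [s w a b|s x xc|s w w' ww'].
- by rewrite !level_map_set.
- have [z zP] := Z_ex s _ xc.
  have [i_inj i_im] := iP (s, tt).
  have [w wz] : exists w, level_map i s w = z.
    apply/i_im; rewrite /= /first_vertex_class /= zP.
    have := ((iP (0, tt)).2 (level_map i 0 (x ord0))).2.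
    rewrite /= /first_vertex_class /= vertex0_id; apply.
    by exists (x ord0).
  exists w => j; apply: (iP (0, tt)).1.
  by apply: etrans (level_map_set _ _ _) _; rewrite wz zP.
- apply: (iP (s, tt)).1; apply: Z_inj => j.
  by apply: etrans (esym (level_map_set i _ _)) _; rewrite ww' level_map_set.
Qed.

(** Two objects of W are isomorphic in W as soon as they are in Z. Only the last
    direction is concerned, so the general case follows levelwise from the case
    of a single direction. *)
Lemma components_pF n (W Z : mSet n.+1) (i : hom W Z) (P : pall n.+1 Z -> Prop) :
  components i P -> hd Z -> components (fmap (pF n) i) P.
Proof.
elim: n => [|n IHn] in W Z i P *; last first.
  move=> iP Z_hd [s k].
  exact: (IHn _ _ _ _ (components_level s iP) (hd_level s Z_hd) k).
move=> iP Z_hd k; have W_ker := components_kernel_pair iP Z_hd.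
have [i_inj i_im] := iP (0, tt).
split=> [c c'|c] /=.
  have [w ->] := to_class_surj c; have [w' ->] := to_class_surj c'.
  by rewrite !iso_classes_mapE => ww'; apply/(kernel_pair_to_class W_ker).
have [z ->] := to_class_surj c.
have := i_im z; rewrite /= /first_vertex_class /= vertex0_id => ->.
split=> [[w <-]|[d]]; first by exists (to_class w); rewrite iso_classes_mapE.
have [w ->] := to_class_surj d; rewrite iso_classes_mapE => wz.
apply/i_im; rewrite /= /first_vertex_class /= vertex0_id -wz.
have := (i_im (level_map i 0 w)).2.
by rewrite /= /first_vertex_class /= vertex0_id; apply; exists w.
Qed.

(** The class of a simplex is that of its first vertex, which is the source of
    its first edge. *)
Lemma class_src n (X : mSet n.+1) (k : mindex n) s (i : 'I_s) (i0 : i = 0 :> nat)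
    (z : mev k (level X s)) :
  class (k := (s, k) : mindex n.+1) (z : mev ((s, k) : mindex n.+1) X) =
  class (k := (0, k) : mindex n.+1)
    (src (row X k) (simpl_map (row X k) (spine i) z)
      : mev ((0, k) : mindex n.+1) X).
Proof.
rewrite src_spine /= /first_vertex_class; congr obj_class.
rewrite !class_map; congr class.
apply: etrans _ (esym (vertex0_id (S := row X k) _ _)).
by congr (simpl_map (row X k) (vertex _) z); exact: val_inj.
Qed.

(** The composite of a chain in W is formed in Z; it lies in W because it has the
    same first vertex as the chain. *)
Lemma components_chains_fill n (W Z : mSet n.+1) (i : hom W Z) P (k : mindex n) :
  components i P -> chains_fill (row Z k) -> chains_fill (row W k).
Proof.
move=> iP Z_fill s s2; have [ex uniq] := Z_fill s s2.
have i_nat m m' (a : monotone m m') (w : level (row W k) m') :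
    fmap (mev k) (level_map i m) (simpl_map (row W k) a w) =
    simpl_map (row Z k) a (fmap (mev k) (level_map i m') w).
  have := congr1 (fun h => fmap (mev k) h w) (level_map_natural i a).
  by rewrite !fmapM.
split=> [e e_chain|w w' ww'].
- have [|z zP] := ex (fun j => fmap (mev k) (level_map i 1) (e j)).
    move=> a b ab; have := e_chain a b ab.
    move=> /(congr1 (fmap (mev k) (level_map i 0))).
    by rewrite /src /tgt !i_nat.
  have [w wz] : exists w, fmap (mev k) (level_map i s) w = z.
    apply/(iP (s, k)).2.
    rewrite (@class_src _ _ _ _ (Ordinal (ltnW s2))) // zP /src -i_nat.
    by apply/(iP (0, k)).2; eexists.
  exists w => j; apply: (iP (1, k)).1.
  by apply: etrans (i_nat _ _ _ _) _; rewrite wz.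
- apply: (iP (s, k)).1; apply: uniq => j.
  by rewrite -!i_nat ww'.
Qed.

(** A union of components of a homotopically discrete n-fold category is
    homotopically discrete: each of the conditions passes to W, the last one
    because p^(n) turns unions of components into unions of components. *)
Lemma components_hd n (W Z : mSet n) (i : hom W Z) P :
  components i P -> hd Z -> hd W.
Proof.
elim: n => [//|n IHn] in W Z i P *.
move=> iP Z_hd; split.
- have [/segalE Z_fill _ _] := Z_hd.
  by apply/segalE => k; exact: components_chains_fill iP (Z_fill k).
- move=> s; exact: IHn (components_level s iP) (hd_level s Z_hd).
- case: n => [|n] in IHn W Z i P iP Z_hd *.
    by have [] := kernel_pair_hd1 (components_kernel_pair iP Z_hd).
  exact: IHn (components_pF iP Z_hd) (hd_pF Z_hd).
Qed.

Lemma components_pall n (W Z : mSet n) (i : hom W Z) P :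
  components i P -> hd Z ->
  injective (fmap (pall n) i) /\
  forall z, P z <-> exists w, fmap (pall n) i w = z.
Proof.
elim: n => [|n IHn] in W Z i P *; first by move=> /(_ tt).
by move=> iP Z_hd; exact: IHn (components_pF iP Z_hd) (hd_pF Z_hd).
Qed.

(** An isomorphism exhibits its source as the union of all components. *)
Lemma iso_hd n (W Z : mSet n) (i : hom W Z) : is_iso i -> hd Z -> hd W.
Proof.
move=> i_iso; apply: (@components_hd _ _ _ i (fun _ => True)) => k.
by have /iso_SET[inj surj] := iso_fmap (mev k) i_iso.
Qed.

(** * Discrete multisimplicial sets *)

(** The multi-index without its last, innermost, entry: the direction on which
    p^(n+1) and d^(n+1) operate. *)
Fixpoint drop_last n : mindex n.+1 -> mindex n :=
  match n return mindex n.+1 -> mindex n with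
  | 0 => fun _ => tt
  | n'.+1 => fun k => (k.1, drop_last k.2)
  end.

(** The sets d^(n+1)(Y)(k_1, ..., k_(n+1)) and Y(k_1, ..., k_n) are equal, but
    only by computation on n; this is the identity between them. *)
Fixpoint of_dF n : forall (Y : mSet n) (k : mindex n.+1),
    mev k (dF n Y) -> mev (drop_last k) Y :=
  match n return forall (Y : mSet n) (k : mindex n.+1),
    mev k (dF n Y) -> mev (drop_last k) Y with
  | 0 => fun Y k y => y
  | n'.+1 => fun Y k y => of_dF (Y := level Y k.1) (k := k.2) y
  end.

Lemma of_dF_iso n (Y : mSet n) (k : mindex n.+1) :
  is_iso (@of_dF n Y k : hom (mev k (dF n Y)) (mev (drop_last k) Y)).
Proof.
elim: n => [|n IHn] in Y k *; first by exists id.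
exact: (IHn (level Y k.1) k.2).
Qed.

Lemma of_dF_map n (Y Y' : mSet n) (f : hom Y Y') (k : mindex n.+1)
    (y : mev k (dF n Y)) :
  of_dF (fmap (mev k) (fmap (dF n) f) y) =
  fmap (mev (drop_last k)) f (of_dF y).
Proof.
elim: n => [//|n IHn] in Y Y' f k y *.
exact: (IHn _ _ (level_map f k.1)).
Qed.

Fixpoint of_dall n (A : SET) : forall k : mindex n, mev k (dall n A) -> A :=
  match n return forall k : mindex n, mev k (dall n A) -> A with
  | 0 => fun k a => a
  | n'.+1 => fun k a => of_dall (k := drop_last k) (of_dF a)
  end.

Lemma of_dall_iso n (A : SET) (k : mindex n) :
  is_iso (@of_dall n A k : hom (mev k (dall n A)) A).
Proof.
elim: n => [|n IHn] in k *; first by exists id.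
exact: iso_comp (of_dF_iso (dall n A) k) (IHn (drop_last k)).
Qed.

Lemma of_dall_map n (A B : SET) (f : hom A B) (k : mindex n)
    (a : mev k (dall n A)) :
  of_dall (fmap (mev k) (fmap (dall n) f) a) = f (of_dall a).
Proof.
elim: n => [//|n IHn] in k a *.
apply: etrans (IHn (drop_last k) (of_dF a)).
by congr (@of_dall n B (drop_last k) _); exact: (of_dF_map (fmap (dall n) f)).
Qed.

(** The class of an element of X(k_1, ..., k_(n+1)) under isomorphism in the last
    direction; on elements this is gamma^(n+1). *)
Fixpoint last_class n : forall (X : mSet n.+1) (k : mindex n.+1),
    mev k X -> mev (drop_last k) (pF n X) :=
  match n return forall (X : mSet n.+1) (k : mindex n.+1),
    mev k X -> mev (drop_last k) (pF n X) with
  | 0 => fun X k x => gamma1_fun x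
  | n'.+1 => fun X k x => last_class (X := level X k.1) (k := k.2) x
  end.

Lemma of_dF_gamma n (X : Cat_hd n.+1) (k : mindex n.+1)
    (x : mev k (full_val X)) :
  of_dF (fmap (mev k) (gamma n X) x) = last_class x.
Proof.
elim: n => [//|n IHn] in X k x *.
exact: (IHn (hd_lvl X k.1)).
Qed.

(** The component of an element can be formed starting from the last direction,
    as gamma_(n) does, instead of from the first one as [class] does. *)
Lemma class_last_class n (X : mSet n.+1) (k : mindex n.+1) (x : mev k X) :
  class (last_class x) = class x.
Proof.
elim: n => [//|n IHn] in X k x *.
exact: (congr1 (@first_vertex_class n.+1 X k.1) (IHn (level X k.1) k.2 x)).
Qed.

Lemma of_dall_gamma_all n (X : Cat_hd n) (k : mindex n)
    (x : mev k (full_val X)) :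
  of_dall (fmap (mev k) (gamma_all n X) x) = class x.
Proof.
elim: n => [//|n IHn] in X k x *.
rewrite -class_last_class -of_dF_gamma.
apply: etrans _ (IHn (hd_p X) (drop_last k) _).
congr (@of_dall n _ (drop_last k) _); rewrite -of_dF_map.
by congr (@of_dF n _ k _); exact: mev_comp.
Qed.

(** * The fibres of an n-fold category *)

(** The third leg of a pullback cone is determined by the first one. *)
Lemma mev_pullback_unique n (k : mindex n) (x y z : mSet n) (f : hom x z) (g : hom y z)
    (l l' : mev k (pullback (@mlim n) f g)) :
  fmap (mev k) (pb1 (@mlim n) f g) l = fmap (mev k) (pb1 (@mlim n) f g) l' ->
  fmap (mev k) (pb2 (@mlim n) f g) l = fmap (mev k) (pb2 (@mlim n) f g) l' ->
  l = l'.
Proof.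
move=> e1 e2; apply: mlim_ev_unique => -[[]|] //.
have e := legP (proj (@mlim n (pullback_diagram f g))) true.
rewrite -e; apply: etrans (mev_comp _ _ _) _; apply: etrans _ (esym (mev_comp _ _ _)).
exact: (congr1 (fmap (mev k) f) e1).
Qed.

Section Fibre.
Variables (n : nat) (X : Cat_hd n.+1) (a b : disc_set X).

(** On elements gamma_(n) is the formation of components, by
    [of_dall_gamma_all]. Hence the fibre X(a,b) consists of the components of X_1
    whose target lies in the component a of X_0 and whose source lies in b. *)
Lemma fibre_components :
  components (pb1 (@mlim n) (endpoints X) (element_pair a b))
    (fun u => fmap (pall n) (tgt (full_val X)) u = a /\
              fmap (pall n) (src (full_val X)) u = b).
Proof.
move=> k; pose A : SET := disc_set X.
have [of_inj of_surj] := (iso_SET _).1 (of_dall_iso unit k).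
have [ofA_inj _] := (iso_SET _).1 (of_dall_iso A k).
have endE (d : hom (level (full_val X) 1) (level (full_val X) 0)) z :
    of_dall (fmap (mev k) (gamma_all n (hd_lvl X 0) ∘ d) z) =
    fmap (pall n) d (class z).
  by rewrite class_map -(of_dall_gamma_all (X := hd_lvl X 0)) mev_comp.
have elE (c : A) t : of_dall (fmap (mev k) (element n c) t) = c.
  by rewrite /element of_dall_map.
have pfst_end : pfst (@mlim n) _ _ ∘ endpoints X = gamma_all n (hd_lvl X 0) ∘ tgt _.
  by rewrite /endpoints /d0d1 prod_map_pairing pfst_pairing.
have psnd_end : psnd (@mlim n) _ _ ∘ endpoints X = gamma_all n (hd_lvl X 0) ∘ src _.
  by rewrite /endpoints /d0d1 prod_map_pairing psnd_pairing.
have pfst_el : pfst (@mlim n) _ _ ∘ element_pair a b = element n a.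
  exact: pfst_pairing.
have psnd_el : psnd (@mlim n) _ _ ∘ element_pair a b = element n b.
  exact: psnd_pairing.
split=> [l l' e|z].
  apply: mev_pullback_unique => //; apply: of_inj.
  by case: (of_dall _) (of_dall _) => [] [].
split=> [[za zb]|[l <-]].
- have [t _] := of_surj tt.
  have fst_eq : of_dall (fmap (mev k) (pfst (@mlim n) _ _ ∘ endpoints X) z) =
      of_dall (fmap (mev k) (pfst (@mlim n) _ _ ∘ element_pair a b) t).
    by rewrite pfst_end pfst_el endE elE.
  have snd_eq : of_dall (fmap (mev k) (psnd (@mlim n) _ _ ∘ endpoints X) z) =
      of_dall (fmap (mev k) (psnd (@mlim n) _ _ ∘ element_pair a b) t).
    by rewrite psnd_end psnd_el endE elE.
  have zt : fmap (mev k) (endpoints X) z = fmap (mev k) (element_pair a b) t.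
    apply: mlim_ev_unique => -[]; apply: etrans (esym (mev_comp _ _ _)) _;
      apply: etrans _ (mev_comp _ _ _).
      exact: (ofA_inj _ _ fst_eq).
    exact: (ofA_inj _ _ snd_eq).
  pose D := pullback_diagram (endpoints X) (element_pair a b).
  have [|l lP] := @mlim_ev_exists n D k (fun v : node D =>
      match v as v' return mev k (dob D v') with
      | None => fmap (mev k) (endpoints X) z
      | Some true => z
      | Some false => t
      end); first by case.
  by exists l; exact: (lP (Some true)).
- have square h : fmap (mev k) (h ∘ endpoints X)
        (fmap (mev k) (pb1 (@mlim n) (endpoints X) (element_pair a b)) l) =
      fmap (mev k) (h ∘ element_pair a b)
        (fmap (mev k) (pb2 (@mlim n) (endpoints X) (element_pair a b)) l).
    apply: etrans (mev_comp _ _ _) _; apply: etrans _ (esym (mev_comp _ _ _)).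
    congr (fmap (mev k) h _).
    apply: etrans (esym (mev_comp _ _ _)) _; apply: etrans _ (mev_comp _ _ _).
    by rewrite pbP.
  by rewrite -!endE -pfst_end -psnd_end !square pfst_el psnd_el !elE.
Qed.

Lemma fibre_hd : hd (fibre a b).
Proof. exact: components_hd fibre_components (hd_level 1 (full_valP X)). Qed.
End Fibre.

(** * The unit of p and d *)

Lemma constant_kernel_pair (A : SET) :
  kernel_pair_nerve (S := constant (opposite Delta) A) (fun a : A => a).
Proof.
split=> [s z i j //|s x xc|s z z' zz'].
  by exists (x ord0) => i; exact: xc.
exact: zz' ord0.
Qed.

(** For the discrete category on a set the isomorphism classes are the points:
    the unit A -> p d A. *)
Lemma dF0_unit_natural (A B : SET) (f : hom A B) :
  (@to_class (dF 0 B) : hom B (pF 0 (dF 0 B))) ∘ f =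
  fmap (compf (pF 0) (dF 0)) f ∘ (@to_class (dF 0 A) : hom A (pF 0 (dF 0 A))).
Proof. by apply: funext => a; rewrite /= iso_classes_mapE. Qed.

Section UnitStep.
Variables (n : nat) (u : nattrans (idf (mSet n)) (compf (pF n) (dF n))).

Lemma dF_unitS_comp_natural (Y : mSet n.+1) (i j : opposite Delta) (a : hom i j) :
  u (level Y j) ∘ fmap (Y : functor _ _) a =
  fmap (pF n.+1 (dF n.+1 Y) : functor _ _) a ∘ u (level Y i).
Proof. exact: (natural u (fmap (Y : functor _ _) a)). Qed.

Definition dF_unitS_comp (Y : mSet n.+1) : hom Y (pF n.+1 (dF n.+1 Y)) :=
  @NatTrans _ _ (Y : functor _ _) (pF n.+1 (dF n.+1 Y) : functor _ _)
    (fun s => u (level Y s)) (@dF_unitS_comp_natural Y).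

Lemma dF_unitS_natural (Y Y' : mSet n.+1) (f : hom Y Y') :
  dF_unitS_comp Y' ∘ f = fmap (compf (pF n.+1) (dF n.+1)) f ∘ dF_unitS_comp Y.
Proof. by apply: nattrans_eq => s; exact: (natural u (level_map f s)). Qed.
End UnitStep.

(** The isomorphism Y -> p^(n+1) d^(n+1) Y. *)
Fixpoint dF_unit n : nattrans (idf (mSet n)) (compf (pF n) (dF n)) :=
  match n with
  | 0 => @NatTrans _ _ (idf (mSet 0)) (compf (pF 0) (dF 0))
           (fun A => @to_class (dF 0 A)) dF0_unit_natural
  | n'.+1 => @NatTrans _ _ (idf (mSet n'.+1)) (compf (pF n'.+1) (dF n'.+1))
               (dF_unitS_comp (dF_unit n')) (dF_unitS_natural (dF_unit n'))
  end.

Lemma dF_unit_iso n (Y : mSet n) : is_iso (dF_unit n Y).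
Proof.
elim: n => [|n IHn] in Y *.
  apply/iso_SET; split=> [a b ab|c].
    exact/(kernel_pair_to_class (constant_kernel_pair Y)).
  by have [a ->] := to_class_surj c; exists a.
by apply: iso_simplicial => s; exact: IHn.
Qed.

(** Applying p^(n+1) to gamma^(n+1) sends the class of x to the class of the class
    of x. *)
Lemma pF_gamma n (X : Cat_hd n.+1) :
  fmap (pF n) (gamma n X) = dF_unit n (pF n (full_val X)).
Proof.
elim: n => [|n IHn] in X *.
  apply: funext => c; have [x ->] := to_class_surj c.
  by rewrite /= iso_classes_mapE /= /gamma1_fun vertex0_id.
by apply: nattrans_eq => s; exact: (IHn (hd_lvl X s)).
Qed.

(** The Segal condition passes from Y to d^(n+1) Y since their rows agree; the
    remaining condition holds since p^(n+1) d^(n+1) Y is isomorphic to Y. *)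
Lemma hd_dF n (Y : mSet n) : hd Y -> hd (dF n Y).
Proof.
elim: n => [|n IHn] in Y *.
  by move=> _; exact: kernel_pair_hd1 (constant_kernel_pair Y).
move=> Y_hd; split.
- have [/segalE Y_fill _ _] := Y_hd; apply/segalE => k s s2.
  have [ex uniq] := Y_fill (drop_last k) s s2.
  have dF_nat m m' (a : monotone m m') (w : level (row (dF n.+1 Y) k) m') :
      of_dF (simpl_map (row (dF n.+1 Y) k) a w) =
      simpl_map (row Y (drop_last k)) a (of_dF w).
    exact: (of_dF_map (simpl_map Y a)).
  have dF_iso m := (iso_SET _).1 (of_dF_iso (level Y m) k).
  split=> [e e_chain|z z' zz'].
    have [|z zP] := ex (fun i => of_dF (e i)).
      by move=> i j ij; rewrite /src /tgt -!dF_nat; congr of_dF; exact: e_chain.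
    have [w wz] := (dF_iso s).2 z.
    by exists w => i; apply: (dF_iso 1).1; rewrite dF_nat wz zP.
  apply: (dF_iso s).1; apply: uniq => i.
  by rewrite -!dF_nat zz'.
- by move=> s; exact: IHn (hd_level s Y_hd).
- have [g [gu ug]] := dF_unit_iso Y.
  by apply: (@iso_hd _ _ _ g) Y_hd; exists (dF_unit n.+1 Y).
Qed.

Lemma hd_dall n (A : SET) : hd (dall n.+1 A).
Proof. by elim: n => [|n IHn]; exact: hd_dF. Qed.

(** * Equivalences are the maps inverted by the functor to sets *)

(** By [dF_unit_iso] the set of components of d^(n+1) Y is that of Y, naturally
    in Y. *)
Lemma pall_dF_iso n (Y Y' : mSet n) (h : hom Y Y') :
  is_iso (fmap (pall n) h) -> is_iso (fmap (pall n.+1) (fmap (dF n) h)).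
Proof.
move=> h_iso.
have unit_iso Z : is_iso (fmap (pall n) (dF_unit n Z)).
  exact: iso_fmap (dF_unit_iso Z).
apply: iso_cancel_right (unit_iso Y) _.
have := congr1 (fmap (pall n)) (natural (dF_unit n) h).
rewrite !fmapM => <-; exact: iso_comp h_iso (unit_iso Y').
Qed.

Lemma pall_gamma_iso n (X : Cat_hd n.+1) : is_iso (fmap (pall n.+1) (gamma n X)).
Proof. by rewrite /= pF_gamma; apply: iso_fmap; exact: dF_unit_iso. Qed.

Lemma pall_gamma_all_iso n (X : Cat_hd n) : is_iso (fmap (pall n) (gamma_all n X)).
Proof.
elim: n => [|n IHn] in X *; first by exists id.
rewrite fmapM; apply: iso_comp (pall_gamma_iso X) _.
exact: pall_dF_iso (IHn (hd_p X)).
Qed.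

(** The fibre X(a,b) has at most one component, since the components of X_1 are
    the edges of an equivalence relation, and it has one exactly when a and b
    have the same image in p^(1)...p^(n+1)(X). As f is injective on this set,
    X(a,b) has a component whenever Y(fa,fb) has one. *)
Lemma fibre_map_iso n (X Y : Cat_hd n.+1) (f : hom X Y) (a b : disc_set X) :
  is_iso (fmap (pall n.+1) f) -> is_iso (fmap (pall n) (fibre_map f a b)).
Proof.
move=> /iso_SET[f_inj _].
have fibre_pall (Z : Cat_hd n.+1) (c d : disc_set Z) := components_pall
  (fibre_components c d) (hd_level 1 (full_valP Z)).
have fibre_ends Z c d (v : pall n (@fibre n Z c d)) :=
  ((fibre_pall Z c d).2 _).2 (ex_intro _ v erefl).
have fibre_uniq Z c d (v v' : pall n (@fibre n Z c d)) : v = v'.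
  have [vt vs] := fibre_ends Z c d v; have [v't v's] := fibre_ends Z c d v'.
  apply: (fibre_pall Z c d).1; apply: (pall_edge_eq (full_valP Z)).
    by rewrite vs v's.
  by rewrite vt v't.
apply/iso_SET; split=> [u u' _|v]; first exact: fibre_uniq.
have [vt vs] := fibre_ends _ _ _ v.
have ba : obj_class (X := full_val X) b = obj_class (X := full_val X) a.
  apply: f_inj; rewrite !obj_class_map.
  by apply/(obj_class_edge _ _ (full_valP Y)); eexists; split; [exact: vs | exact: vt].
have [u [us ut]] := (obj_class_edge _ _ (full_valP X)).1 ba.
have [w _] := ((fibre_pall X a b).2 u).1 (conj ut us).
by exists w; exact: fibre_uniq.
Qed.

(** In the inductive step the condition on the image of f under the last p is by
    the induction hypothesis the bijectivity itself, and this implies the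
    condition on the fibres. *)
Lemma nequivP n (X Y : Cat_hd n.+1) (f : hom X Y) :
  nequiv f <-> is_iso (fmap (pall n.+1) f).
Proof.
elim: n => [|n IHn] in X Y f *.
  exact: equivalence_iso_classes (full_valP X) (full_valP Y).
split=> [[_ /IHn //]|f_iso]; split; last exact/IHn.
move=> a b; exists (fibre_hd a b), (fibre_hd (disc_set_map f a) (disc_set_map f b)).
by apply/IHn; exact: fibre_map_iso.
Qed.

(* The n >= 1 of the text is n.+1 here: [nequiv n], [gamma n] and
   [gamma_all n.+1] are the (n+1)-equivalences, gamma^(n+1) and gamma_(n+1). *)
Theorem mainTheorem5 (n : nat) :
  (forall (X Y Z : Cat_hd n.+1) (f : hom X Y) (g : hom Y Z),
     [/\ nequiv f -> nequiv g -> nequiv (g ∘ f),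
         nequiv f -> nequiv (g ∘ f) -> nequiv g
       & nequiv g -> nequiv (g ∘ f) -> nequiv f]) /\
  (forall X : Cat_hd n.+1,
     (exists h : hd (dp n X), @nequiv n X (HdOb h) (gamma n X)) /\
     (exists h : hd (disc n.+1 X),
        @nequiv n X (HdOb h) (gamma_all n.+1 X))).
Proof.
split=> [X Y Z f g|X].
  have pM : fmap (pall n.+1) (g ∘ f : hom (full_val X) (full_val Z)) =
    fmap (pall n.+1) g ∘ fmap (pall n.+1) f := fmapM _ _ _.
  split=> /nequivP h1 /nequivP h2; apply/nequivP.
  - by rewrite pM; exact: iso_comp.
  - by apply: iso_cancel_right h1 _; rewrite -pM.
  - by apply: iso_cancel_left h1 _; rewrite -pM.
split.
  by exists (hd_dF (hd_pF (full_valP X))); apply/nequivP; exact: pall_gamma_iso.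
by exists (hd_dall _ _); apply/nequivP; exact: pall_gamma_all_iso.
Qed.
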